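(* Let $Y$ and $\hat Y$ be continuous Lagrangian paths on $[a,b]$. Then $$\mathcal N(Y,[a,b])-\mathcal N(\hat Y,[a,b])=\mu(Y(b),\hat Y(b))-\mu(Y(a),\hat Y(a))+\mathcal N(Z_{\hat Y}^{-1}Y,[a,b]),$$ $$\mathcal N^*(Y,[a,b])-\mathcal N^*(\hat Y,[a,b])=\mu^*(Y(a),\hat Y(a))-\mu^*(Y(b),\hat Y(b))+\mathcal N^*(Z_{\hat Y}^{-1}Y,[a,b]),$$ where $Z_{\hat Y}(t)$ is the symplectic and orthogonal matrix associated with $\hat Y(t)$. Moreover, the matrix $Z_{\hat Y}(t)$ in both formulas can be replaced by an arbitrary continuous symplectic matrix $\hat Z(t)$ with $\hat Z(t)E=\hat Y(t)$ on $[a,b]$.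
   Context: Notation. $n\in\mathbb N$, $[a,b]\subseteq\mathbb R$, $\mathcal J=\begin{pmatrix}0&I\\ -I&0\end{pmatrix}\in\mathbb R^{2n\times2n}$, $E=\begin{pmatrix}0\\ I\end{pmatrix}\in\mathbb R^{2n\times n}$. A real $2n\times 2n$ matrix $S$ is symplectic if $S^T\mathcal JS=\mathcal J$. A Lagrangian plane is a constant $Y\in\mathbb R^{2n\times n}$ with $Y^T\mathcal JY=0$ and $\operatorname{rank}Y=n$. A continuous Lagrangian path on $[a,b]$ is a continuous $Y:[a,b]\to\mathbb R^{2n\times n}$ such that every $Y(t)$ is a Lagrangian plane. We write $Y=\begin{pmatrix}X\\ U\end{pmatrix}$ with $n\times n$ blocks (similarly $\hat Y$ with $\hat X,\hat U$). The Wronskian is $W(Y,\hat Y)=Y^T\mathcal J\hat Y$. Comparative index. For Lagrangian planes $Y,\hat Y$ put $\mathcal M=(I-X^\dagger X)W(Y,\hat Y)$, $V=I-\mathcal M^\dagger\mathcal M$, $\mathcal P=V[W(Y,\hat Y)]^TX^\dagger\hat XV$ (a symmetric matrix), where $\dagger$ is the Moore–Penrose pseudoinverse. The comparative index and dual comparative index are $\mu(Y,\hat Y)=\operatorname{rank}\mathcal M+\operatorname{ind}\mathcal P$, $\mu^*(Y,\hat Y)=\operatorname{rank}\mathcal M+\operatorname{ind}(-\mathcal P)$, with $\operatorname{ind}$ the number of negative eigenvalues. Oscillation numbers. For a continuous Lagrangian path $Y$ on $[a,b]$ take a partition $a=t_0<t_1<\dots<t_p=b$ and real symplectic matrix functions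 $R_k(t)$, $k=0,\dots,p-1$, with $R_k$ continuous on $[t_k,t_{k+1}]$ and such that, for each $k$, both $\operatorname{rank}W(R_k(t)E,Y(t))$ and $\operatorname{rank}\big((I\ \,0)R_k(t)E\big)$ are constant for $t\in[t_k,t_{k+1}]$. Then $$\mathcal N(Y,[a,b]):=\sum_{k=0}^{p-1}\big[\mu(Y(t_{k+1}),R_k(t_{k+1})E)-\mu(Y(t_k),R_k(t_k)E)\big],$$ $$\mathcal N^*(Y,[a,b]):=\sum_{k=0}^{p-1}\big[\mu^*(Y(t_k),R_k(t_k)E)-\mu^*(Y(t_{k+1}),R_k(t_{k+1})E)\big].$$ Such partitions and systems exist and the values do not depend on their choice. Symplectic orthogonal matrix of a path. $Z_Y(t)=\begin{pmatrix}\mathcal JY(t)K_Y(t)&Y(t)K_Y(t)\end{pmatrix}$, $K_Y(t)=[Y^T(t)Y(t)]^{-1/2}>0$; $Z_Y(t)$ is symplectic and orthogonal. *)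

(* Defs.v *)
From HB Require Import structures.
From mathcomp Require Import all_boot all_order all_algebra.
From mathcomp Require Import all_classical all_reals all_analysis.
From mathcomp Require Import polyrcf.

Set Implicit Arguments.
Unset Strict Implicit.
Unset Printing Implicit Defensive.

Import Order.TTheory GRing.Theory Num.Theory.
Import numFieldNormedType.Exports.

Local Open Scope classical_set_scope.
Local Open Scope ring_scope.

Section Pseudoinverse.
Variable R : realType.

Definition is_mpinv m n (A : 'M[R]_(m, n)) (B : 'M[R]_(n, m)) : Prop :=
  [/\ A *m B *m A = A, B *m A *m B = B,
      (A *m B)^T = A *m B & (B *m A)^T = B *m A].

(* [pinvmx] is a different, non-symmetric partial inverse. The choice below is
   legitimate: see [mpinv_uniq] and [mpinvP]. *)
Definition mpinv m n (A : 'M[R]_(m, n)) : 'M[R]_(n, m) :=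
  xget 0 [set B | is_mpinv A B].

Lemma mpinv_uniq m n (A : 'M[R]_(m, n)) (B C : 'M[R]_(n, m)) :
  is_mpinv A B -> is_mpinv A C -> B = C.
Proof.
move=> [B1 B2 B3 B4] [C1 C2 C3 C4].
have AB : A *m B = A *m C.
  rewrite -{1}C1 -mulmxA -C3 -B3 -trmx_mul.
  by rewrite mulmxA B1 C3.
have BA : B *m A = C *m A.
  rewrite -{1}C1 -{1}mulmxA (mulmxA B A) -B4 -{1}C4 -trmx_mul.
  by rewrite -(mulmxA C A) (mulmxA A B) B1 C4.
by rewrite -B2 BA -mulmxA AB mulmxA C2.
Qed.

Lemma gram_unitmx r n (F : 'M[R]_(r, n)) : row_free F -> F *m F^T \in unitmx.
Proof.
move=> Ffree; rewrite -row_free_unit -kermx_eq0; apply/rowV0P => v /sub_kermxP.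
move=> /(congr1 (fun z => z *m v^T)); rewrite mul0mx mulmxA -mulmxA -trmx_mul.
move=> /matrixP/(_ 0 0); rewrite !mxE => /eqP.
rewrite psumr_eq0 => [/allP vF0|i _]; last by rewrite [_^T _ _]mxE -expr2 sqr_ge0.
apply: (row_free_inj Ffree); rewrite mul0mx; apply/rowP => i.
have := vF0 i (mem_index_enum _).
by rewrite [_^T _ _]mxE mulf_eq0 orbb [RHS]mxE => /eqP.
Qed.

Lemma mpinvP m n (A : 'M[R]_(m, n)) : is_mpinv A (mpinv A).
Proof.
apply: xgetPex.
have [r [C [F [AE FU CU]]]] : exists r (C : 'M[R]_(m, r)) (F : 'M[R]_(r, n)),
    [/\ A = C *m F, F *m F^T \in unitmx & C^T *m C \in unitmx].
  exists (\rank A), (col_base A), (row_base A); split.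
  - by rewrite mulmx_base.
  - exact/gram_unitmx/row_base_free.
  - rewrite -{2}(trmxK (col_base A)); apply: gram_unitmx.
    by rewrite /row_free mxrank_tr; apply: col_base_full.
pose FF := invmx (F *m F^T); pose CC := invmx (C^T *m C).
have FFs : FF^T = FF by rewrite trmx_inv trmx_mul trmxK.
have CCs : CC^T = CC by rewrite trmx_inv trmx_mul trmxK.
have FV : F *m F^T *m FF = 1%:M by rewrite mulmxV.
have CV : CC *m (C^T *m C) = 1%:M by rewrite mulVmx.
pose B := F^T *m FF *m (CC *m C^T).
have AB : A *m B = C *m CC *m C^T.
  by rewrite AE /B -(mulmxA C) 2!(mulmxA F) FV mul1mx mulmxA.
have BA : B *m A = F^T *m FF *m F.
  by rewrite AE /B -mulmxA (mulmxA _ C F) -(mulmxA CC) CV mul1mx.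
exists B; split.
- by rewrite AB AE -!mulmxA (mulmxA C^T) (mulmxA CC) CV mul1mx.
- by rewrite BA /B -(mulmxA _ F) 2!(mulmxA F) FV mul1mx.
- by rewrite AB !trmx_mul trmxK CCs mulmxA.
- by rewrite BA !trmx_mul trmxK FFs mulmxA.
Qed.

End Pseudoinverse.

Section Symplectic.
Variables (R : realType) (n : nat).

Definition Jmx : 'M[R]_(n + n) := block_mx 0 1%:M (- 1%:M) 0.

Definition Emx : 'M[R]_(n + n, n) := col_mx 0 1%:M.

Definition symplectic (S : 'M[R]_(n + n)) : Prop := S^T *m Jmx *m S = Jmx.

Definition lagrangian_plane (Y : 'M[R]_(n + n, n)) : Prop :=
  Y^T *m Jmx *m Y = 0 /\ \rank Y = n.

Definition lagrangian_path (a b : R) (Y : R -> 'M[R]_(n + n, n)) : Prop :=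
  {within `[a, b], continuous Y} /\
  (forall t, a <= t <= b -> lagrangian_plane (Y t)).

Definition wronskian (Y Yh : 'M[R]_(n + n, n)) : 'M[R]_n := Y^T *m Jmx *m Yh.

End Symplectic.

Arguments Emx {R} n.

(* Eigenvalues are counted with their (algebraic) multiplicity. *)
Definition ind (R : realType) n (P : 'M[R]_n) : nat :=
  (\sum_(x <- rootsR (char_poly P) | (x < 0)%R) mup x (char_poly P))%N.

Section ComparativeIndex.
Variables (R : realType) (n : nat).
Implicit Types Y Yh : 'M[R]_(n + n, n).

Definition ciM Y Yh : 'M[R]_n :=
  (1%:M - mpinv (usubmx Y) *m usubmx Y) *m wronskian Y Yh.

Definition ciV Y Yh : 'M[R]_n := 1%:M - mpinv (ciM Y Yh) *m ciM Y Yh.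

Definition ciP Y Yh : 'M[R]_n :=
  ciV Y Yh *m (wronskian Y Yh)^T *m mpinv (usubmx Y) *m usubmx Yh *m ciV Y Yh.

Definition mu Y Yh : nat := (\rank (ciM Y Yh) + ind (ciP Y Yh))%N.

Definition mu_dual Y Yh : nat := (\rank (ciM Y Yh) + ind (- ciP Y Yh))%N.

End ComparativeIndex.

Section OscillationNumbers.
Variables (R : realType) (n : nat).
Implicit Type Y : R -> 'M[R]_(n + n, n).

(* The values of [t] beyond index [p], those of [S] from index [p] on and those
   of [S k] outside [t k, t k.+1] are irrelevant. *)
Definition osc_system (a b : R) Y
    (p : nat) (t : nat -> R) (S : nat -> R -> 'M[R]_(n + n)) : Prop :=
  [/\ t 0%N = a, t p = b,
      (forall k, (k < p)%N -> t k < t k.+1) &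
      forall k, (k < p)%N ->
        [/\ {within `[t k, t k.+1], continuous (S k)},
            (forall s, t k <= s <= t k.+1 -> symplectic (S k s)),
            (forall s s', t k <= s <= t k.+1 -> t k <= s' <= t k.+1 ->
              \rank (wronskian (S k s *m Emx n) (Y s)) =
              \rank (wronskian (S k s' *m Emx n) (Y s'))) &
            (forall s s', t k <= s <= t k.+1 -> t k <= s' <= t k.+1 ->
              \rank ((row_mx 1%:M 0 : 'M[R]_(n, n + n)) *m S k s *m Emx n) =
              \rank ((row_mx 1%:M 0 : 'M[R]_(n, n + n)) *m S k s' *m Emx n))]].

Definition osc_sum Y (p : nat) (t : nat -> R)
    (S : nat -> R -> 'M[R]_(n + n)) : int :=
  \sum_(k < p)
    ((mu (Y (t k.+1)) (S k (t k.+1) *m Emx n))%:Z -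
     (mu (Y (t k)) (S k (t k) *m Emx n))%:Z).

Definition osc_sum_dual Y (p : nat) (t : nat -> R)
    (S : nat -> R -> 'M[R]_(n + n)) : int :=
  \sum_(k < p)
    ((mu_dual (Y (t k)) (S k (t k) *m Emx n))%:Z -
     (mu_dual (Y (t k.+1)) (S k (t k.+1) *m Emx n))%:Z).

(* For a continuous Lagrangian path the set of values below is a singleton:
   admissible systems exist and all of them give the same sum. *)
Definition osc (a b : R) Y : int :=
  xget 0 [set N | exists p t S, osc_system a b Y p t S /\ N = osc_sum Y p t S].

Definition osc_dual (a b : R) Y : int :=
  xget 0
    [set N | exists p t S, osc_system a b Y p t S /\ N = osc_sum_dual Y p t S].

End OscillationNumbers.

Section SymplecticOrthogonal.
Variables (R : realType) (n : nat).

Definition posdef (K : 'M[R]_n) : Prop :=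
  K^T = K /\ (forall v : 'rV[R]_n, v != 0 -> 0 < (v *m K *m v^T) 0 0).

(* The unique symmetric positive definite K with K^2 = A^-1, for A symmetric
   positive definite. *)
Definition inv_sqrtmx (A : 'M[R]_n) : 'M[R]_n :=
  xget 0 [set K | posdef K /\ K *m K = invmx A].

Definition Zmx (Y : 'M[R]_(n + n, n)) : 'M[R]_(n + n) :=
  let K := inv_sqrtmx (Y^T *m Y) in row_mx (Jmx R n *m Y *m K) (Y *m K).

End SymplecticOrthogonal.

(* Main.v *)
Require Import Defs.
From HB Require Import structures.
From mathcomp Require Import all_boot all_order all_algebra.
From mathcomp Require Import all_classical all_reals all_analysis.
From mathcomp Require Import polyrcf complex.
From mathcomp Require Import ring lra zify.

(** For Lagrangian planes [A], [B] transverse to a Lagrangian plane [T],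
    [Delta T A B] is the difference of the symmetric matrices whose graphs are
    [A] and [B] in coordinates where [T] is vertical. It is additive,
    [Delta T A B + Delta T B C = Delta T A C], it only involves Wronskians (so it
    is invariant under symplectic maps), and its rank is that of [W(A, B)]. The
    inertia formula for generalized Schur complements gives
      [mu A B = ind (Delta T A B) + ind (Delta T B E) - ind (Delta T A E)],
    and the same with opposite signs for [mu_dual].

    The index of a continuous family of symmetric matrices of constant rank is
    locally constant. So along an admissible system [R] the increments of
    [mu (Y t) (R t *m E)] are locally those of [- ind (Delta T (Y t) E)], whatever
    [R] is, and an oscillation number is the total increment of a function that
    is locally [- ind (Delta T (Y t) E)] up to a constant. For [T t = Z t *m X] with
    [X] a constant plane, the function attached to [Z^-1 Y] is locally
    [- ind (Delta T (Y t) (Yh t))] because [Z E] and [Yh] span the same plane, and the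
    theorem is the displayed formula for [mu (Y t) (Yh t)]. *)

Set Implicit Arguments.
Unset Strict Implicit.
Unset Printing Implicit Defensive.

Import Order.TTheory GRing.Theory Num.Theory.
Import numFieldNormedType.Exports.

Local Open Scope classical_set_scope.
Local Open Scope ring_scope.

(** * The index of a symmetric matrix *)

Section NegativeRoots.
Variable R : rcfType.
Implicit Types p q : {poly R}.

Definition negroots p : nat :=
  (\sum_(x <- rootsR p | (x < 0)%R) mup x p)%N.

Lemma in_rootsR p x : p != 0 -> (x \in rootsR p) = root p x.
Proof. by move=> p0; have := roots_on_rootsR p0 x; rewrite in_itv. Qed.

(** Non-roots have multiplicity 0, so the range may be enlarged; the roots of a product then serve
    both factors. *)
Lemma negroots_sum p (s : seq R) : p != 0 -> uniq s ->
  {subset rootsR p <= s} ->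
  negroots p = (\sum_(x <- s | (x < 0)%R) mup x p)%N.
Proof.
move=> p0 us sub; rewrite [RHS](bigID (mem (rootsR p))) /=.
rewrite [X in (_ + X)%N]big1 ?addn0; last first.
  by move=> x /andP[_]; rewrite in_rootsR // => /mupNroot.
rewrite /negroots big_mkcondr /= -[RHS]big_mkcondr /= -[RHS]big_filter_cond.
rewrite -big_filter -[RHS]big_filter -!filter_predI.
apply: perm_big; apply: uniq_perm; rewrite ?filter_uniq ?uniq_roots //.
move=> x; rewrite !mem_filter /=.
by case xp: (x \in rootsR p); rewrite ?andbF //= (sub _ xp) !andbT.
Qed.

Lemma negrootsM p q : p != 0 -> q != 0 ->
  negroots (p * q) = (negroots p + negroots q)%N.
Proof.
move=> p0 q0; have pq0 : p * q != 0 by rewrite mulf_neq0.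
rewrite (@negroots_sum p (rootsR (p * q))) ?uniq_roots //; last first.
  by move=> x; rewrite !in_rootsR // rootM => ->.
rewrite (@negroots_sum q (rootsR (p * q))) ?uniq_roots //; last first.
  by move=> x; rewrite !in_rootsR // rootM => ->; rewrite orbT.
by rewrite /negroots -big_split /=; apply: eq_bigr => x _; rewrite mupM.
Qed.

Lemma negroots_XsubC (c : R) : negroots ('X - c%:P) = (c < 0)%R.
Proof.
rewrite (@negroots_sum _ [:: c]) ?polyXsubC_eq0 //; last first.
  by move=> x; rewrite in_rootsR ?polyXsubC_eq0 // root_XsubC inE.
rewrite big_mkcond big_seq1 -['X - _]expr1 mup_XsubCX eqxx.
by case: (c < 0).
Qed.

Lemma negroots_prod (I : finType) (d : I -> R) :
  negroots (\prod_i ('X - (d i)%:P)) = #|[pred i | d i < 0]|.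
Proof.
rewrite -sum1_card big_mkcond /=.
elim: (index_enum I) => [|i s IHs].
  by rewrite !big_nil /negroots rootsRC big_nil.
rewrite !big_cons negrootsM ?polyXsubC_eq0 ?monic_neq0 ?monic_prod_XsubC //.
by rewrite negroots_XsubC IHs inE; case: (d i < 0).
Qed.

End NegativeRoots.

(** * The spectral theorem and the inertia of symmetric matrices *)

Section Spectral.
Variable R : realType.

Lemma dotmx_ge0 n (v : 'rV[R]_n) : 0 <= (v *m v^T) 0 0.
Proof. by rewrite mxE sumr_ge0 // => i _; rewrite mxE -expr2 sqr_ge0. Qed.

Lemma dotmx_gt0 n (v : 'rV[R]_n) : v != 0 -> 0 < (v *m v^T) 0 0.
Proof.
move=> v0; rewrite lt_def dotmx_ge0 andbT; apply: contra v0.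
rewrite mxE psumr_eq0 => [/allP vF0|i _]; last by rewrite mxE -expr2 sqr_ge0.
apply/eqP/rowP => i; have := vF0 i (mem_index_enum _).
by rewrite !mxE mulf_eq0 orbb => /eqP.
Qed.

Lemma dotmx_scalar n (u v : 'rV[R]_n) : u *m v^T = ((u *m v^T) 0 0)%:M.
Proof. exact: mx11_scalar. Qed.

(* [H] is the reflection exchanging [u] and [v]. *)
Lemma householder n (u v : 'rV[R]_n) : u *m u^T = 1%:M -> v *m v^T = 1%:M ->
  exists H : 'M[R]_n, [/\ H^T = H, H *m H = 1%:M & u *m H = v].
Proof.
move=> uu vv; case: (eqVneq v u) => [->|vu].
  by exists 1%:M; rewrite trmx1 !mulmx1.
have [w wE] : exists w, w = v - u by exists (v - u).
pose c : R := (w *m w^T) 0 0.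
have w0 : w != 0 by rewrite wE subr_eq0.
have c0 : c != 0 by rewrite gt_eqF // dotmx_gt0.
have ww : w *m w^T = c%:M by apply: dotmx_scalar.
pose k : R := (u *m v^T) 0 0; have uv : u *m v^T = k%:M by apply: dotmx_scalar.
have vu1 : v *m u^T = k%:M by rewrite -[v *m _]trmxK trmx_mul trmxK uv tr_scalar_mx.
have cE : c = 2 - 2 * k.
  have /matrixP/(_ 0 0) := ww.
  rewrite {1 2}wE [in LHS]linearB /= mulmxBl !mulmxBr uu vv uv vu1 !mxE !eqxx /= !mulr1n; lra.
have uw : u *m w^T = (- (c / 2))%:M.
  rewrite wE linearB /= mulmxBr uu uv -raddfB /= cE; congr (_ %:M); by field.
exists (1%:M - (2 / c) *: (w^T *m w)); split.
- by rewrite linearB linearZ /= trmx1 trmx_mul trmxK.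
- have XX : (w^T *m w) *m (w^T *m w) = c *: (w^T *m w).
    by rewrite mulmxA -(mulmxA w^T w) ww mul_mx_scalar -scalemxAl.
  rewrite mulmxBl !mulmxBr !mul1mx mulmx1 -scalemxAl -scalemxAr XX !scalerA.
  have -> : 2 / c * (2 / c) * c = 2 / c + 2 / c by field.
  by rewrite scalerDl opprB addrK subrK.
- rewrite mulmxBr mulmx1 -scalemxAr mulmxA uw mul_scalar_mx scalerA.
  rewrite (_ : 2 / c * _ = -1) ?scaleN1r ?opprK ?wE; last by field.
  by rewrite addrC subrK.
Qed.

(** Let [x] and [y] be the real and imaginary parts of a complex eigenvector for [l]. Symmetry of
    [A] gives [Im l * (|x|^2 + |y|^2) = 0], so [l] is real and [x] or [y] is a real eigenvector. *)
Lemma symmetric_eigenvector n (A : 'M[R]_n.+1) : A^T = A ->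
  exists (v : 'rV[R]_n.+1) (l : R), v *m v^T = 1%:M /\ v *m A = l *: v.
Proof.
move=> As.
have [l /eigenvalueP[z zA z0]] :=
  eigenvalue_closed (map_mx (real_complex R) A) (ltn0Sn n).
pose x := map_mx (@complex.Re R) z; pose y := map_mx (@complex.Im R) z.
have xA : x *m A = complex.Re l *: x - complex.Im l *: y.
  apply/rowP => j; have /rowP/(_ j) /(congr1 (@complex.Re R)) := zA.
  rewrite !mxE raddf_sum /=; case: (z 0 j) => a b /=; case: l {zA} => c d /= <-.
  by apply: eq_bigr => i _; rewrite !mxE; case: (z 0 i) => e f /=; rewrite mulr0 subr0.
have yA : y *m A = complex.Re l *: y + complex.Im l *: x.
  apply/rowP => j; have /rowP/(_ j) /(congr1 (@complex.Im R)) := zA.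
  rewrite !mxE raddf_sum /=; case: (z 0 j) => a b /=; case: l {zA xA} => c d /= <-.
  by apply: eq_bigr => i _; rewrite !mxE; case: (z 0 i) => e f /=; rewrite mulr0 add0r.
have xy : x *m y^T = ((x *m y^T) 0 0)%:M by apply: dotmx_scalar.
have yx : y *m x^T = x *m y^T by rewrite -[LHS]trmxK trmx_mul trmxK xy tr_scalar_mx -xy.
have l0 : complex.Im l = 0.
  have E : x *m A *m y^T = (y *m A *m x^T)^T by rewrite !trmx_mul trmxK As mulmxA.
  have /matrixP/(_ 0 0) := E; rewrite xA yA mulmxBl mulmxDl -!scalemxAl yx xy.
  rewrite (dotmx_scalar x x) (dotmx_scalar y y) !mxE /= !mulr1n => {}E.
  have /eqP : complex.Im l * ((x *m x^T) 0 0 + (y *m y^T) 0 0) = 0.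
    by rewrite !mxE; lra.
  rewrite mulf_eq0 => /orP[/eqP //|/eqP xxyy].
  have := dotmx_ge0 x; have := dotmx_ge0 y.
  case: (eqVneq x 0) => [x0|/dotmx_gt0]; last by lra.
  case: (eqVneq y 0) => [y0|/dotmx_gt0]; last by lra.
  case/eqP: z0; apply/rowP => i; move/rowP/(_ i): x0; move/rowP/(_ i): y0.
  by rewrite !mxE; case: (z 0 i) => /= ? ? -> ->.
have [w [w0 wA]] : exists w : 'rV[R]_n.+1, w != 0 /\ w *m A = complex.Re l *: w.
  case: (eqVneq x 0) => [x0|x0]; last by exists x; rewrite xA l0 scale0r subr0.
  exists y; rewrite yA l0 scale0r addr0; split=> //; apply: contra z0 => /eqP y0.
  apply/eqP/rowP => i; move/rowP/(_ i): x0; move/rowP/(_ i): y0.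
  by rewrite !mxE; case: (z 0 i) => /= ? ? -> ->.
pose q := (Num.sqrt ((w *m w^T) 0 0))^-1.
exists (q *: w), (complex.Re l); split.
  rewrite linearZ /= -scalemxAl -scalemxAr scalerA dotmx_scalar scale_scalar_mx.
  rewrite -expr2 exprVn sqr_sqrtr ?dotmx_ge0 // mulVf //.
  by rewrite gt_eqF // dotmx_gt0.
by rewrite -scalemxAl wA scalerA mulrC -scalerA.
Qed.

(** Induction on the size: a reflection carries the first basis vector to a unit eigenvector, and
    conjugation by it splits off a block of size 1. *)
Lemma symmetric_spectral n (A : 'M[R]_n) : A^T = A ->
  exists (Q : 'M[R]_n) (d : 'rV[R]_n),
    Q *m Q^T = 1%:M /\ A = Q^T *m diag_mx d *m Q.
Proof.
elim: n A => [|n IHn] A As.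
  by exists 0, 0; split; apply/matrixP => -[].
move: A As; rewrite -[n.+1]/(1 + n)%N => A As.
have [v [l [vv vA]]] : exists (v : 'rV[R]_(1 + n)) (l : R),
  v *m v^T = 1%:M /\ v *m A = l *: v by apply: symmetric_eigenvector.
pose e : 'rV[R]_(1 + n) := row_mx 1%:M 0.
have ee : e *m e^T = 1%:M.
  by rewrite tr_row_mx mul_row_col trmx1 trmx0 mulmx1 mulmx0 addr0.
have [H [Hs HH eH]] := householder ee vv.
have [B HAH] : exists B : 'M[R]_(1 + n), B = H *m A *m H by eexists.
have Bs : B^T = B by rewrite HAH !trmx_mul Hs As mulmxA.
have eB : e *m B = l *: e.
  by rewrite HAH !mulmxA eH vA -scalemxAl -eH -mulmxA HH mulmx1.
have BE : B = block_mx l%:M 0 0 (drsubmx B).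
  have eu : ulsubmx B = l%:M /\ ursubmx B = 0.
    move: eB; rewrite -{1}[B]submxK mul_row_block !mul1mx !mul0mx !addr0.
    rewrite scale_row_mx scaler0 -scalemx1 => /eq_row_mx.
    by rewrite !scalemx1.
  have dl : dlsubmx B = 0 by rewrite -Bs -trmx_ursub eu.2 trmx0.
  by rewrite -{1}[B]submxK eu.1 eu.2 dl.
have [|Q [d [QQ dE]]] := IHn (drsubmx B); first by rewrite -{2}Bs trmx_drsub.
exists (block_mx 1%:M 0 0 Q *m H : 'M[R]_(1 + n)), (row_mx l%:M d); split.
  rewrite trmx_mul Hs mulmxA -[_ *m H *m H]mulmxA HH mulmx1.
  rewrite tr_block_mx !trmx0 trmx1 mulmx_block.
  by rewrite !mulmx0 !mul0mx !addr0 !add0r mulmx1 QQ -scalar_mx_block.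
have -> : A = H *m B *m H by rewrite HAH !mulmxA HH mul1mx -mulmxA HH mulmx1.
rewrite trmx_mul Hs !mulmxA; congr (_ *m _); rewrite -!mulmxA; congr (_ *m _).
rewrite tr_block_mx !trmx0 trmx1 BE dE diag_mx_row !mulmx_block.
rewrite !(mulmx0, mul0mx, addr0, add0r, mul1mx, mulmx1, mulmxA).
congr block_mx; apply/matrixP => i j; rewrite !ord1 !mxE eqxx //.
Qed.

Lemma char_poly_conj n (P Q A : 'M[R]_n) : P *m Q = 1%:M ->
  char_poly (Q *m A *m P) = char_poly A.
Proof.
move=> PQ; rewrite /char_poly /char_poly_mx.
have PQp : map_mx polyC P *m map_mx polyC Q = 1%:M.
  by rewrite -map_mxM PQ map_mx1.
have QPp := mulmx1C PQp.
have -> : 'X%:M - map_mx polyC (Q *m A *m P) =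
    map_mx polyC Q *m ('X%:M - map_mx polyC A) *m map_mx polyC P.
  rewrite !map_mxM mulmxBr mulmxBl; congr (_ - _).
  by rewrite -mulmxA mul_scalar_mx -scalemxAr QPp scalemx1.
by rewrite !det_mulmx mulrAC -det_mulmx QPp det1 mul1r.
Qed.

Lemma char_poly_diag n (d : 'rV[R]_n) :
  char_poly (diag_mx d) = \prod_i ('X - (d 0 i)%:P).
Proof.
rewrite /char_poly /char_poly_mx map_diag_mx -diag_const_mx -linearB /= det_diag.
by apply: eq_bigr => i _; rewrite !mxE.
Qed.

Lemma ind_spectral n (Q : 'M[R]_n) (d : 'rV[R]_n) : Q *m Q^T = 1%:M ->
  ind (Q^T *m diag_mx d *m Q) = #|[pred i | d 0 i < 0]|.
Proof.
by move=> QQ; rewrite /ind char_poly_conj // char_poly_diag -negroots_prod.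
Qed.

Lemma rank_diag_mx n (d : 'rV[R]_n) :
  \rank (diag_mx d) = #|[pred i | d 0 i != 0]|.
Proof.
rewrite -sum1_card big_mkcond /=.
elim: n d => [|n IHn] d; first by rewrite big_ord0 thinmx0 mxrank0.
move: d; rewrite -[n.+1]/(1 + n)%N => d.
rewrite -{1}[d]hsubmxK diag_mx_row rank_diag_block_mx IHn big_split_ord /=.
congr (_ + _)%N; last by apply: eq_bigr => i _; rewrite !inE mxE.
rewrite big_ord1 [diag_mx _]mx11_scalar rank_rV -scalemx1 scaler_eq0.
by rewrite oner_eq0 orbF inE !mxE eqxx mulr1n; case: eqP.
Qed.

Lemma quad_spectral n (Q : 'M[R]_n) (d u : 'rV[R]_n) : Q *m Q^T = 1%:M ->
  ((u *m Q) *m (Q^T *m diag_mx d *m Q) *m (u *m Q)^T) 0 0 =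
  \sum_i d 0 i * u 0 i ^+ 2.
Proof.
move=> QQ; rewrite trmx_mul !mulmxA -(mulmxA u Q) QQ mulmx1.
rewrite -(mulmxA _ Q Q^T) QQ mulmx1 mxE; apply: eq_bigr => i _.
by rewrite mul_mx_diag !mxE expr2 mulrCA mulrA.
Qed.

Lemma norm_orthogonal n (Q : 'M[R]_n) (u : 'rV[R]_n) : Q *m Q^T = 1%:M ->
  ((u *m Q) *m (u *m Q)^T) 0 0 = \sum_i u 0 i ^+ 2.
Proof.
move=> QQ; rewrite trmx_mul mulmxA -(mulmxA u Q) QQ mulmx1 mxE.
by apply: eq_bigr => i _; rewrite mxE expr2.
Qed.

(** [U] meets the sum [W] of the eigenspaces with nonnegative eigenvalue only in 0, and [W] has
    dimension [n - ind A]. With [ind_neg] this is the variational description of the index. *)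
Lemma ind_max n m (A : 'M[R]_n) (U : 'M[R]_(m, n)) : A^T = A ->
  (forall v : 'rV_n, (v <= U)%MS -> v != 0 -> (v *m A *m v^T) 0 0 < 0) ->
  (\rank U <= ind A)%N.
Proof.
move=> /symmetric_spectral [Q [d [QQ ->]]] neg; rewrite ind_spectral //.
pose e : 'rV[R]_n := \row_i ((0 <= d 0 i)%R : nat)%:R.
have Qu : Q \in unitmx by have [] := mulmx1_unit QQ.
pose W := diag_mx e *m Q.
have rW : \rank W = #|[pred i | 0 <= d 0 i]|.
  rewrite mxrankMfree ?row_free_unit // rank_diag_mx; apply: eq_card => i.
  by rewrite !inE mxE pnatr_eq0 eqb0 negbK.
have UW : (U :&: W)%MS = 0.
  apply/eqP/rowV0P => v; rewrite sub_capmx => /andP[vU /submxP[w]].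
  rewrite /W mulmxA => vE.
  apply/eqP; apply: contraT => v0; have := neg v vU v0; rewrite vE quad_spectral //.
  rewrite ltNge sumr_ge0 // => i _; rewrite mul_mx_diag !mxE.
  by case: (lerP 0 (d 0 i)) => di; rewrite ?mulr0 ?expr0n ?mulr0 // mulr1 mulr_ge0 ?sqr_ge0.
have := mxrank_sum_cap U W; rewrite UW mxrank0 addn0 rW => E.
have := rank_leq_col (U + W)%MS; rewrite E.
have -> : #|[pred i | d 0 i < 0]| = (n - #|[pred i | (0 <= d 0 i)%R]|)%N.
  rewrite -[X in (X - _)%N]card_ord -(cardC [pred i | 0 <= d 0 i]) addKn.
  by apply: eq_card => i; rewrite !inE ltNge.
by lia.
Qed.

(** [U] is spanned by the eigenvectors with negative eigenvalue. The uniform constant [k] keeps the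
    form negative there under small perturbations. *)
Lemma ind_neg n (A : 'M[R]_n) : A^T = A ->
  exists (U : 'M[R]_n) (k : R), [/\ 0 < k, \rank U = ind A &
    forall v : 'rV_n, (v <= U)%MS ->
      (v *m A *m v^T) 0 0 <= - (k * (v *m v^T) 0 0)].
Proof.
move=> /symmetric_spectral [Q [d [QQ ->]]]; rewrite ind_spectral //.
pose e : 'rV[R]_n := \row_i ((d 0 i < 0)%R : nat)%:R.
have Qu : Q \in unitmx by have [] := mulmx1_unit QQ.
(* [k] is the smallest [- d 0 i] over the negative eigenvalues, capped at 1, which also covers the
   case where there are none. *)
exists (diag_mx e *m Q), (\big[Num.min/1]_(i | d 0 i < 0) - d 0 i); split.
- by elim/big_ind: _ => [|x y x0 y0|i]; rewrite ?oppr_gt0 // lt_min x0 y0.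
- rewrite mxrankMfree ?row_free_unit // rank_diag_mx; apply: eq_card => i.
  by rewrite !inE mxE pnatr_eq0 eqb0 negbK.
- move=> v /submxP[w]; rewrite mulmxA => ->; rewrite quad_spectral // norm_orthogonal //.
  rewrite mulr_sumr -sumrN; apply: ler_sum => i _; rewrite mul_mx_diag !mxE.
  case: (ltrP (d 0 i) 0) => di; last by rewrite !(mulr0, expr0n) oppr0.
  rewrite mulr1 -mulNr ler_wpM2r ?sqr_ge0 // lerNr.
  exact: bigmin_le_cond.
Qed.

Lemma rank_ind n (A : 'M[R]_n) : A^T = A -> \rank A = (ind A + ind (- A))%N.
Proof.
move=> /symmetric_spectral [Q [d [QQ ->]]].
have Qu : Q \in unitmx by have [] := mulmx1_unit QQ.
rewrite mxrankMfree ?row_free_unit // -[\rank _]mxrank_tr trmx_mul trmxK.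
rewrite mxrankMfree ?row_free_unit // tr_diag_mx rank_diag_mx -mulNmx -mulmxN -linearN /=.
rewrite !ind_spectral // -(cardID [pred i | d 0 i < 0]); congr (_ + _)%N.
  by apply: eq_card => i; rewrite !inE /=; case: ltrgtP.
by apply: eq_card => i; rewrite !inE !mxE oppr_lt0 /=; case: ltrgtP.
Qed.

(** Sylvester's law of inertia. A negative subspace for [B] is carried by [invmx D^T] to one for
    [D^T *m B *m D], which gives one inequality; the inverse congruence gives the other. *)
Lemma ind_congr n (A C : 'M[R]_n) : A^T = A -> C \in unitmx ->
  ind (C^T *m A *m C) = ind A.
Proof.
have le (B D : 'M[R]_n) : B^T = B -> D \in unitmx ->
    (ind B <= ind (D^T *m B *m D))%N.
  move=> Bs Du; have [U [k [k0 <- neg]]] := ind_neg Bs.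
  have DTu : invmx D^T \in unitmx by rewrite unitmx_inv unitmx_tr.
  rewrite -(mxrankMfree U (B := invmx D^T)) ?row_free_unit //.
  apply: ind_max => [|v /submxP[w ->] v0]; first by rewrite !trmx_mul trmxK Bs mulmxA.
  have -> : w *m (U *m invmx D^T) *m (D^T *m B *m D) *m (w *m (U *m invmx D^T))^T =
      (w *m U) *m B *m (w *m U)^T.
    rewrite !trmx_mul [(invmx _)^T]trmx_inv trmxK !mulmxA.
    rewrite mulmxKV ?unitmx_tr //.
    by rewrite mulmxK.
  apply: le_lt_trans (neg _ (submxMl _ _)) _; rewrite oppr_lt0 mulr_gt0 // dotmx_gt0 //.
  by apply: contra v0 => /eqP wU; rewrite mulmxA wU mul0mx.
move=> As Cu; apply/eqP; rewrite eqn_leq le // andbT.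
have {2}-> : A = (invmx C)^T *m (C^T *m A *m C) *m invmx C.
  rewrite !mulmxA mulmxK // trmx_inv mulVmx ?unitmx_tr // mul1mx //.
by apply: le; rewrite ?unitmx_inv // !trmx_mul trmxK As mulmxA.
Qed.

Lemma ind_congrZ n (s : R) (A C : 'M[R]_n) : A^T = A -> C \in unitmx ->
  ind (s *: (C^T *m A *m C)) = ind (s *: A).
Proof.
move=> As Cu; rewrite -(@ind_congr _ (s *: A) C) //; last by rewrite linearZ /= As.
by rewrite -scalemxAr -scalemxAl.
Qed.

Lemma ind_add_orth n (A B : 'M[R]_n) : A *m B = 0 ->
  ind (A + B) = (ind A + ind B)%N.
Proof.
move=> AB0.
(* [(X - A) (X - B) = X (X - (A + B))] *)
have E : char_poly A * char_poly B = 'X^n * char_poly (A + B).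
  rewrite /char_poly -det_mulmx -det_scalar -det_mulmx; congr (\det _).
  have ab0 : map_mx polyC A *m map_mx polyC B = 0 by rewrite -map_mxM AB0 map_mx0.
  rewrite /char_poly_mx map_mxD; move: (map_mx _ A) (map_mx _ B) ab0 => a b ab0.
  rewrite mulmxBl [a *m _]mulmxBr ab0 subr0 mul_mx_scalar !mul_scalar_mx.
  by rewrite -scalerBr opprD addrA addrAC.
have nz (C : 'M[R]_n) : char_poly C != 0 by rewrite monic_neq0 // char_poly_monic.
have := congr1 (@negroots R) E; rewrite !negrootsM ?monic_neq0 ?monicXn ?char_poly_monic //.
rewrite /ind -/(negroots _) => ->; suff -> : negroots ('X^n : {poly R}) = 0%N by [].
rewrite /negroots big_mkcond /= big1_seq // => x /andP[_].
rewrite in_rootsR ?monic_neq0 ?monicXn // rootE hornerXn => /eqP xn.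
case: ltP => // x0; move/eqP: xn; rewrite expf_eq0 => /andP[_ /eqP xE].
by rewrite xE ltxx in x0.
Qed.

Lemma ind_block_diag m n (A : 'M[R]_m) (B : 'M[R]_n) :
  ind (block_mx A 0 0 B) = (ind A + ind B)%N.
Proof.
rewrite /ind -!/(negroots _) -negrootsM ?monic_neq0 ?char_poly_monic //.
congr negroots; rewrite /char_poly -(det_ublock _ 0); congr (\det _).
rewrite /char_poly_mx map_block_mx !map_mx0 scalar_mx_block.
by rewrite opp_block_mx add_block_mx !oppr0 !addr0.
Qed.

(** Exchanging the column blocks shows that the rank is twice that of [M]. Changing the sign of one
    block of coordinates makes the matrix congruent to its opposite, so half of the rank is
    negative. *)
Lemma ind_hyperbolic m n (M : 'M[R]_(m, n)) :
  ind (block_mx 0 M M^T 0) = \rank M.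
Proof.
pose H := block_mx 0 M M^T 0.
have Hs : H^T = H by rewrite tr_block_mx !trmx0 trmxK.
have rH : \rank H = (\rank M + \rank M)%N.
  pose P : 'M[R]_(m + n, n + m) := block_mx 0 1%:M 1%:M 0.
  have Pf : row_free P.
    apply/row_freeP; exists (block_mx 0 1%:M 1%:M 0); rewrite mulmx_block.
    by rewrite !(mulmx0, mul0mx, mulmx1, addr0, add0r) -scalar_mx_block.
  rewrite -(mxrankMfree _ Pf) mulmx_block.
  rewrite !(mulmx0, mul0mx, mulmx1, addr0, add0r) rank_diag_block_mx.
  by rewrite mxrank_tr.
have HN : ind (- H) = ind H.
  pose S : 'M[R]_(m + n) := block_mx 1%:M 0 0 (- 1%:M).
  have Su : S \in unitmx.
    by rewrite unitmxE det_ublock det1 mul1r -scaleN1r detZ det1 mulr1 unitrX ?unitrN1.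
  rewrite -(ind_congr Hs Su); congr ind.
  rewrite tr_block_mx !trmx0 linearN /= !trmx1 !mulmx_block opp_block_mx.
  by rewrite !(mulmx0, mul0mx, mul1mx, mulmx1, addr0, add0r, mulmxN, mulNmx, oppr0).
have := rank_ind Hs; rewrite HN rH !addnn => /double_inj ->.
by [].
Qed.

End Spectral.

(** * Comparative index and transversal planes *)

Section Schur.
Variable R : realType.

Lemma mpinv_sym n (N : 'M[R]_n) : N^T = N -> (mpinv N)^T = mpinv N.
Proof.
move=> Ns; apply: (@mpinv_uniq _ _ _ N); last exact: mpinvP.
move: (mpinv N) (mpinvP N) => G [G1 G2 G3 G4].
have GN : G^T *m N = N *m G by rewrite -G3 trmx_mul Ns.
have NG : N *m G^T = G *m N by rewrite -G4 trmx_mul Ns.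
split; rewrite ?GN ?NG //; apply: trmx_inj; rewrite -?NG -?GN.
- by rewrite !trmx_mul trmxK Ns mulmxA.
- by rewrite !trmx_mul !trmxK Ns mulmxA.
Qed.

Lemma mpinv_comm n (N : 'M[R]_n) : N^T = N -> mpinv N *m N = N *m mpinv N.
Proof.
move=> Ns; have [_ _ _ <-] := mpinvP N.
by rewrite trmx_mul Ns mpinv_sym.
Qed.

(** Both sides are the orthogonal projection onto the row space of [N], which is also that of
    [k *m N]. *)
Lemma mpinv_proj_unit m n (N : 'M[R]_(m, n)) (k : 'M[R]_m) : k \in unitmx ->
  mpinv (k *m N) *m (k *m N) = mpinv N *m N.
Proof.
move=> ku; have [X1 _ _ X4] := mpinvP (k *m N); have [N1 _ _ N4] := mpinvP N.
set p := _ *m (k *m N) in X4 *; set q := _ *m N in N4 *.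
have Np : N *m p = N.
  by apply: (can_inj (mulKmx ku)); rewrite /p !mulmxA -(mulmxA k N) in X1 *.
have qp : q *m p = q by rewrite /q -mulmxA Np.
have pq : p *m q = p by rewrite {1}/p /q -!mulmxA (mulmxA N) N1.
by rewrite -X4 -pq trmx_mul X4 N4 qp.
Qed.

(* Block congruences reduce the matrix to [N, M; M^T, V S V] with [N M = 0] and
   [M V = 0], the sum of two symmetric matrices whose product vanishes. *)
Lemma ind_schur m n (N : 'M[R]_m) (W : 'M[R]_(m, n)) (D : 'M[R]_n) (s : R) :
  N^T = N -> D^T = D -> s != 0 ->
  let M := (1%:M - mpinv N *m N) *m W in
  let V := 1%:M - mpinv M *m M in
  ind (s *: block_mx N W W^T D) =
  (ind (s *: N) + \rank M + ind (s *: (V *m (D - W^T *m mpinv N *m W) *m V)))%N.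
Proof.
move=> Ns Ds s0 M V.
have [G1 G2 G3 G4] := mpinvP N; have Gs := mpinv_sym Ns; have Gc := mpinv_comm Ns.
set G := mpinv N in G1 G2 G3 G4 Gs Gc M V *.
have [K1 K2 K3 K4] := mpinvP M.
rewrite -/V; set K := mpinv M in K1 K2 K3 K4 V *.
set S := D - _.
have Ss : S^T = S by rewrite linearB /= !trmx_mul Ds Gs trmxK mulmxA.
have NM : N *m M = 0 by rewrite mulmxA mulmxBr mulmx1 mulmxA G1 subrr mul0mx.
have GM : G *m M = 0.
  by rewrite mulmxA mulmxBr mulmx1 mulmxA -(mulmxA G) Gc mulmxA G2 subrr mul0mx.
have MT : M^T = W^T - W^T *m G *m N.
  by rewrite trmx_mul linearB /= trmx1 trmx_mul Ns Gs mulmxBr mulmx1 -Gc mulmxA.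
have ME : W - N *m G *m W = M by rewrite /M mulmxBl mul1mx Gc.
have [E EE] : exists E, E = K *m M by eexists.
have Es : E^T = E by rewrite EE.
have VE : V = 1%:M - E by rewrite EE.
have SE : S = D - W^T *m G *m W by [].
clearbody S V K M G.
have NK : N *m K^T = 0.
  by rewrite -K2 -mulmxA trmx_mul K3 !mulmxA NM !mul0mx.
have MK : M^T *m K^T = E by rewrite -trmx_mul -EE.
have MEM : E *m M^T = M^T by rewrite -Es -trmx_mul EE mulmxA K1.
(* The congruence by [C1] replaces [W] by [M], its part orthogonal to the range of [N], and [D] by
   the Schur complement [S]. *)
pose C1 : 'M[R]_(m + n) := block_mx 1%:M (- (G *m W)) 0 1%:M.
(* [X] is chosen so that [M^T X + X^T M] cancels [S - V S V]. The factor 1/2 shares [E S E] equally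
   between the two terms, and [N X = 0] leaves the other blocks unchanged. *)
pose X := - (K^T *m (S - 2^-1 *: (S *m E))).
pose C2 : 'M[R]_(m + n) := block_mx 1%:M X 0 1%:M.
have C1u : C1 \in unitmx by rewrite unitmxE det_ublock !det1 mulr1 unitr1.
have C2u : C2 \in unitmx by rewrite unitmxE det_ublock !det1 mulr1 unitr1.
have E1 : C1^T *m block_mx N W W^T D *m C1 = block_mx N M M^T S.
  have -> : C1^T *m block_mx N W W^T D = block_mx N W M^T S.
    rewrite tr_block_mx !trmx1 trmx0 mulmx_block.
    rewrite !(mulmx1, mul1mx, mulmx0, mul0mx, addr0, add0r).
    by rewrite linearN /= trmx_mul Gs !mulNmx MT SE ![- _ + _]addrC.
  rewrite mulmx_block !(mulmx1, mul1mx, mulmx0, mul0mx, addr0, add0r) !mulmxN.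
  have MG : M^T *m G = 0 by apply: trmx_inj; rewrite trmx_mul trmxK Gs GM trmx0.
  by rewrite !mulmxA MG mul0mx oppr0 add0r addrC ME.
have NX : N *m X = 0 by rewrite mulmxN mulmxA NK mul0mx oppr0.
have E2 : C2^T *m block_mx N M M^T S *m C2 = block_mx N M M^T (V *m S *m V).
  rewrite tr_block_mx !trmx1 trmx0 !mulmx_block !(mulmx1, mul1mx, mulmx0, mul0mx, addr0, add0r).
  have XN : X^T *m N = 0 by apply: trmx_inj; rewrite trmx_mul trmxK Ns NX trmx0.
  rewrite XN NX !add0r; congr block_mx.
  have MX : M^T *m X = - (E *m S) + 2^-1 *: (E *m S *m E).
    by rewrite /X mulmxN mulmxA MK mulmxBr -scalemxAr opprB addrC mulmxA.
  have XM : X^T *m M = - (S *m E) + 2^-1 *: (E *m S *m E).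
    apply: trmx_inj; rewrite trmx_mul trmxK MX linearD linearN linearZ /=.
    by rewrite !trmx_mul Es Ss mulmxA.
  have -> : V *m S *m V = S - E *m S - S *m E + E *m S *m E.
    by rewrite VE mulmxBl mul1mx mulmxBr mulmx1 mulmxBl opprB addrA addrAC.
  rewrite XM MX; move: (E *m S *m E) (E *m S) (S *m E) => e f g.
  by apply/matrixP => i j; rewrite !mxE; field.
pose A := block_mx N 0 0 (V *m S *m V); pose B := block_mx 0 M M^T 0.
have VM : V *m M^T = 0 by rewrite VE mulmxBl mul1mx MEM subrr.
have AB : (s *: A) *m (s *: B) = 0.
  rewrite -scalemxAl -scalemxAr /A /B mulmx_block.
  rewrite !(mulmx0, mul0mx, addr0, add0r) NM -(mulmxA _ V) VM mulmx0.
  by rewrite -/(0 : 'M[R]_(m + n)) block_mx0 !scaler0.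
have ABE : block_mx N M M^T (V *m S *m V) = A + B.
  by rewrite add_block_mx !addr0 !add0r.
have Fs : (s *: block_mx N W W^T D)^T = s *: block_mx N W W^T D.
  by rewrite linearZ /= tr_block_mx Ns Ds trmxK.
have C12u : C1 *m C2 \in unitmx by rewrite unitmx_mul C1u.
rewrite -(ind_congr Fs C12u) -scalemxAr -scalemxAl trmx_mul.
rewrite !mulmxA -(mulmxA C2^T) -(mulmxA C2^T) E1 E2 ABE scalerDr ind_add_orth //.
rewrite /A /B !scale_block_mx !scaler0 ind_block_diag.
have -> : s *: M^T = (s *: M)^T by rewrite linearZ.
rewrite ind_hyperbolic.
by rewrite mxrank_scale_nz // addnAC.
Qed.

End Schur.

(* [s = 1] gives [mu] and [s = -1] gives [mu_dual]. The definition is locked since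
   comparing two of its instances by conversion unfolds the pseudoinverses. *)
HB.lock Definition mu_signed (R : realType) (n : nat) (s : R) (A B : 'M[R]_(n + n, n)) : nat :=
  (\rank (ciM A B) + ind (s *: ciP A B))%N.

(** * Lagrangian planes, transversality and the formula for the comparative index *)

Section Planes.
Variables (R : realType) (n : nat).
Implicit Types T A B C : 'M[R]_(n + n, n).

Local Notation J := (Jmx R n).
Local Notation W := wronskian.

Lemma trmx_J : J^T = - J.
Proof. by rewrite tr_block_mx opp_block_mx linearN /= !trmx0 !trmx1 oppr0 opprK. Qed.

Lemma mulJJ : J *m J = - 1%:M.
Proof.
rewrite mulmx_block !(mulmx0, mul0mx, addr0, add0r, mulmx1, mul1mx).
by rewrite scalar_mx_block opp_block_mx oppr0.
Qed.

Lemma J_unit : J \in unitmx.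
Proof. by have /mulmx1_unit[] : J *m (- J) = 1%:M by rewrite mulmxN mulJJ opprK. Qed.

Lemma tr_wronskian A B : (W A B)^T = - W B A.
Proof. by rewrite !trmx_mul trmxK trmx_J mulNmx mulmxN mulmxA. Qed.

Lemma wronskian_mulr A B (K L : 'M[R]_n) : W (A *m K) (B *m L) = K^T *m W A B *m L.
Proof. by rewrite /wronskian trmx_mul !mulmxA. Qed.

Lemma wronskian_symplectic (Z : 'M[R]_(n + n)) A B :
  symplectic Z -> W (Z *m A) (Z *m B) = W A B.
Proof.
by move=> Zs; rewrite /wronskian trmx_mul -!mulmxA (mulmxA J Z) (mulmxA Z^T) (mulmxA Z^T J) Zs mulmxA.
Qed.

Lemma symplectic_unit (Z : 'M[R]_(n + n)) : symplectic Z -> Z \in unitmx.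
Proof.
move=> Zs; have : Z^T *m J *m Z \in unitmx by rewrite Zs J_unit.
by rewrite !unitmx_mul => /andP[].
Qed.

Lemma symplectic_lagrangian (Z : 'M[R]_(n + n)) A :
  symplectic Z -> lagrangian_plane A -> lagrangian_plane (Z *m A).
Proof.
move=> Zs [A0 rA]; split; first by have := wronskian_symplectic A A Zs; rewrite /wronskian A0.
by rewrite -mxrank_tr trmx_mul mxrankMfree ?mxrank_tr // row_free_unit unitmx_tr symplectic_unit.
Qed.

(** A Lagrangian plane is its own symplectic complement: the columns of [T] are killed by [T^T J],
    whose kernel has dimension [2n - n = n], the rank of [T]. *)
Lemma lagrangian_orth T m (Z : 'M[R]_(n + n, m)) : lagrangian_plane T ->
  T^T *m J *m Z = 0 -> exists X, Z = T *m X.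
Proof.
move=> [T0 rT] TZ.
have Jf : row_free (J *m (1%:M : 'M[R]_(n + n))) by rewrite mulmx1 row_free_unit J_unit.
have TJ : \rank (T^T *m J)^T = n.
  by rewrite mxrank_tr mxrankMfree ?mxrank_tr // row_free_unit J_unit.
have sub (k : nat) (Y : 'M[R]_(n + n, k)) : T^T *m J *m Y = 0 -> (Y^T <= kermx (T^T *m J)^T)%MS.
  by move=> TY; apply/sub_kermxP; rewrite -trmx_mul TY trmx0.
have TE : (kermx (T^T *m J)^T <= T^T)%MS.
  have := mxrank_leqif_sup (sub _ _ T0); rewrite mxrank_ker mxrank_tr rT TJ addnK.
  by move=> [_ /esym]; rewrite eqxx.
have /submxP[X XE] := submx_trans (sub _ _ TZ) TE.
by exists X^T; rewrite -[LHS]trmxK XE trmx_mul trmxK.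
Qed.

(** For Lagrangian planes this says that the column spaces meet only in 0. *)
Definition transverse T A := W T A \in unitmx.

(** The Wronskian of the frames of [A] and [B], both normalized so that their Wronskian with [T] is
    the identity. *)
Definition Delta T A B : 'M[R]_n :=
  (invmx (W T A))^T *m W A B *m invmx (W T B).

(** For the normalized frames [a], [b], [c], the difference [a - b] is symplectically orthogonal to
    [T], hence some [T X]. Since [W(b, b) = 0], both [W(a, b)] and [W(a, c) - W(b, c)] equal
    [X^T]. *)
Lemma Delta_add T A B C : lagrangian_plane T ->
  lagrangian_plane B -> transverse T A -> transverse T B -> transverse T C ->
  Delta T A B + Delta T B C = Delta T A C.
Proof.
move=> LT [B0 _] TA TB TC.
have DE Y Z : Delta T Y Z = W (Y *m invmx (W T Y)) (Z *m invmx (W T Z)).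
  by rewrite wronskian_mulr.
have T1 Y : transverse T Y -> T^T *m J *m (Y *m invmx (W T Y)) = 1%:M.
  by move=> TY; rewrite mulmxA mulmxV.
have [X XE] : exists X, A *m invmx (W T A) - B *m invmx (W T B) = T *m X.
  by apply: lagrangian_orth => //; rewrite mulmxBr !T1 // subrr.
have BB : W (B *m invmx (W T B)) (B *m invmx (W T B)) = 0.
  by rewrite wronskian_mulr /W B0 mulmx0 mul0mx.
rewrite !DE; move: BB (T1 _ TB) (T1 _ TC) XE.
move: (A *m _) (B *m _) (C *m _) => a b c bb Tb Tc.
move=> /eqP; rewrite subr_eq => /eqP ->.
rewrite /wronskian linearD /= !mulmxDl -!/(W b _) bb addr0 trmx_mul.
by rewrite -!mulmxA !(mulmxA T^T) Tb Tc.
Qed.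

(** Transposition gives [- Delta T B A], which additivity along [A], [B], [A] identifies with
    [Delta T A B]. *)
Lemma Delta_sym T A B : lagrangian_plane T -> lagrangian_plane A ->
  lagrangian_plane B -> transverse T A -> transverse T B -> (Delta T A B)^T = Delta T A B.
Proof.
move=> LT LA LB TA TB.
have -> : (Delta T A B)^T = - Delta T B A.
  rewrite /Delta trmx_mul [(_ *m W A B)^T]trmx_mul trmxK tr_wronskian.
  by rewrite mulNmx mulmxN mulmxA.
have := Delta_add LT LB TA TB TA.
rewrite [Delta T A A]/Delta [W A A](_ : _ = 0); last by case: LA.
by rewrite mulmx0 mul0mx => /eqP; rewrite addr_eq0 => /eqP.
Qed.

Lemma Delta_rank T A B : transverse T A -> transverse T B -> \rank (Delta T A B) = \rank (W A B).
Proof.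
move=> TA TB; rewrite mxrankMfree ?row_free_unit ?unitmx_inv //.
rewrite -mxrank_tr trmx_mul mxrankMfree ?mxrank_tr //.
by rewrite row_free_unit unitmx_tr unitmx_tr unitmx_inv.
Qed.

Lemma Delta_symplectic (Z : 'M[R]_(n + n)) T A B : symplectic Z ->
  Delta (Z *m T) (Z *m A) (Z *m B) = Delta T A B.
Proof. by move=> Zs; rewrite /Delta !wronskian_symplectic. Qed.

(** Only the plane spanned by [B] matters, so [Z *m E] may stand for [Yh] when they differ by an
    invertible factor. *)
Lemma Delta_mulr T A B (K : 'M[R]_n) : K \in unitmx -> transverse T B ->
  Delta T A (B *m K) = Delta T A B.
Proof.
move=> Ku TB; have WK C : W C (B *m K) = W C B *m K by rewrite /wronskian mulmxA.
rewrite /Delta !WK.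
have -> : invmx (W T B *m K) = invmx K *m invmx (W T B).
  have WKu : W T B *m K \in unitmx by rewrite unitmx_mul Ku andbT.
  apply: (can_inj (mulKmx WKu)); rewrite mulmxV //.
  by rewrite mulmxA mulmxK // mulmxV.
by rewrite !mulmxA mulmxK.
Qed.

Lemma lagrangian_E : lagrangian_plane (Emx n : 'M[R]_(n + n, n)).
Proof.
split.
  rewrite tr_col_mx trmx0 trmx1 mul_row_block mul_row_col.
  by rewrite !(mulmx0, mul0mx, addr0, add0r).
by rewrite -mxrank_tr tr_col_mx trmx0 trmx1 rank_row_0mx mxrank1.
Qed.

Lemma wronskian_E A : W A (Emx n) = (usubmx A)^T.
Proof.
rewrite /wronskian -{1}[A]vsubmxK tr_col_mx mul_row_block mul_row_col.
by rewrite !(mulmx0, mul0mx, addr0, add0r, mulmx1).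
Qed.

(** With [P = Delta T A B], [Q = Delta T B E] and [N = P + Q = Delta T A E], a congruence turns
    [diag(P, Q)] into a block matrix with diagonal blocks congruent to [N] and [P] and off-diagonal
    block [W(A, B)]. The inertia formula [ind_schur] for it yields the rank of [ciM] and the index
    of [ciP]. *)
Lemma mu_signed_Delta (s : R) T A B : s != 0 -> lagrangian_plane T ->
  lagrangian_plane A -> lagrangian_plane B ->
  transverse T A -> transverse T B -> transverse T (Emx n) ->
  (mu_signed s A B + ind (s *: Delta T A (Emx n)) =
  ind (s *: Delta T A B) + ind (s *: Delta T B (Emx n)))%N.
Proof.
move=> s0 LT LA LB TA TB TE.
have LE := lagrangian_E.
pose X := usubmx A; pose Xh := usubmx B.
have [al alE] : exists al, al = W T A by eexists.
have [be beE] : exists be, be = W T B by eexists.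
have [ga gaE] : exists ga, ga = W T (Emx n) by eexists.
have [P PE] : exists P, P = Delta T A B by eexists.
have [Q QE] : exists Q, Q = Delta T B (Emx n) by eexists.
have [N NE] : exists N, N = Delta T A (Emx n) by eexists.
have PQ : P + Q = N by rewrite PE QE NE Delta_add.
have Ps : P^T = P by rewrite PE Delta_sym.
have Qs : Q^T = Q by rewrite QE Delta_sym.
have Ns : N^T = N by rewrite NE Delta_sym.
have alu : al \in unitmx by rewrite alE.
have beu : be \in unitmx by rewrite beE.
have gau : ga \in unitmx by rewrite gaE.
have WE : W A B = al^T *m P *m be.
  by rewrite PE /Delta -alE -beE !mulmxA mulmxKV // -trmx_mul mulVmx // trmx1 mul1mx.
have XE : X = ga^T *m N *m al.
  apply: trmx_inj; rewrite -wronskian_E !trmx_mul trmxK Ns NE /Delta -alE -gaE !mulmxA.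
  by rewrite mulmxKV // -trmx_mul mulVmx // trmx1 mul1mx.
have XhE : Xh = ga^T *m Q *m be.
  apply: trmx_inj; rewrite -wronskian_E !trmx_mul trmxK Qs QE /Delta -beE -gaE !mulmxA.
  by rewrite mulmxKV // -trmx_mul mulVmx // trmx1 mul1mx.
pose N' := al^T *m N *m al; pose D := be^T *m P *m be.
have N's : N'^T = N' by rewrite !trmx_mul trmxK Ns mulmxA.
have Ds : D^T = D by rewrite !trmx_mul trmxK Ps mulmxA.
pose k := ga^T *m invmx al^T.
have ku : k \in unitmx by rewrite unitmx_mul unitmx_inv !unitmx_tr gau.
have XN : X = k *m N'.
  by rewrite XE /k /N' !mulmxA mulmxKV ?unitmx_tr.
have projE : mpinv X *m X = mpinv N' *m N' by rewrite XN mpinv_proj_unit.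
have ME : ciM A B = (1%:M - mpinv N' *m N') *m W A B by rewrite -projE.
have [_ G2 _ _] := mpinvP N'; have Gc := mpinv_comm N's.
(* After compression by [ciV A B], the Schur complement is the matrix [ciP A B] of the comparative
   index. *)
have VE : ciV A B *m (D - (W A B)^T *m mpinv N' *m W A B) *m ciV A B = ciP A B.
  have [M1 _ _ M4] := mpinvP (ciM A B).
  have Vs : (ciV A B)^T = ciV A B by rewrite linearB /= M4 trmx1.
  have WV : mpinv X *m X *m (W A B *m ciV A B) = W A B *m ciV A B.
    have : ciM A B *m ciV A B = 0 by rewrite mulmxBr mulmx1 mulmxA M1 subrr.
    rewrite {1}/ciM -/X mulmxBl mul1mx mulmxBl => /eqP; rewrite subr_eq0 => /eqP E.
    by rewrite [RHS]E !mulmxA.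
  have VW : ciV A B *m (W A B)^T *m (mpinv X *m X) = ciV A B *m (W A B)^T.
    have [_ _ _ X4] := mpinvP X.
    by apply: trmx_inj; rewrite trmx_mul X4 trmx_mul trmxK Vs.
  have XhX : Xh = X *m invmx al *m be - k *m W A B.
    rewrite XhE XE WE /k mulmxK // !mulmxA mulmxKV ?unitmx_tr //.
    by rewrite -PQ mulmxDr mulmxDl addrC addKr.
  rewrite /ciP -/X -/Xh XhX; clear ME M1 M4.
  move: (ciV A B) Vs WV VW => V Vs WV VW; rewrite !mulmxBr !mulmxBl; congr (_ - _).
    rewrite !mulmxA; congr (_ *m _).
    move: VW; rewrite !mulmxA => ->; rewrite /D WE !trmx_mul trmxK Ps.
    by rewrite !mulmxA mulmxK.
  have WVE : W A B *m V = N' *m (mpinv N' *m W A B *m V).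
    by rewrite -{1}WV projE Gc !mulmxA.
  rewrite -(mulmxA _ (k *m W A B)) -(mulmxA k) WVE (mulmxA k) -XN.
  by rewrite (mulmxA _ X) -(mulmxA _ _ X) VW !mulmxA.
pose C : 'M[R]_(n + n) := block_mx al be al 0.
have Cu : C \in unitmx.
  have /mulmx1_unit[//] : C *m block_mx 0 (invmx al) (invmx be) (- invmx be) = 1%:M.
  rewrite mulmx_block !mulmxN !mulmxV // !(mulmx0, mul0mx, oppr0, add0r, addr0) subrr.
  by rewrite -scalar_mx_block.
have FE : block_mx N' (W A B) (W A B)^T D = C^T *m block_mx P 0 0 Q *m C.
  rewrite tr_block_mx trmx0 !mulmx_block !(mulmx0, mul0mx, add0r, addr0).
  by rewrite -mulmxDl -mulmxDr PQ /D WE !trmx_mul trmxK Ps mulmxA.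
have Ki : ind (s *: N') = ind (s *: N) by exact: ind_congrZ.
have Fi : ind (s *: block_mx N' (W A B) (W A B)^T D) = (ind (s *: P) + ind (s *: Q))%N.
  rewrite FE (ind_congrZ s _ Cu); last by rewrite tr_block_mx Ps Qs !trmx0.
  by rewrite scale_block_mx !scaler0 ind_block_diag.
have := ind_schur (W A B) N's Ds s0; rewrite /= -ME -/(ciV A B) VE Fi Ki.
by rewrite mu_signed.unlock -PE -QE -NE; lia.
Qed.

End Planes.

(** * Limits of matrices *)

Section MatrixLimits.
Variables (R : realType) (T : Type) (F : set_system T).
Context {FF : Filter F}.

Definition mxcvg m n (A : T -> 'M[R]_(m, n)) (L : 'M[R]_(m, n)) : Prop :=
  forall i j, A t i j @[t --> F] --> L i j.

Lemma mxcvgP m n (A : T -> 'M[R]_(m, n)) (L : 'M[R]_(m, n)) :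
  A t @[t --> F] --> L <-> mxcvg A L.
Proof.
split=> [AL i j|AL].
  apply/cvgrPdist_lt => e e0.
  have /cvg_mx_entourageP/(_ _ (entourage_ball _ (PosNum e0))) AL' := AL.
  suff : F (A @^-1` [set N | forall i j, (L i j, N i j) \in
      [set xy : R * R | ball xy.1 e xy.2]]).
    by apply: filterS => t /= /(_ i j); rewrite inE.
  exact: AL'.
apply/cvg_mx_entourageP => B; rewrite -entourage_ballE => -[e /= e0 eB].
apply: filter_forall => i; apply: filter_forall => j.
have /cvgrPdist_lt/(_ _ e0) := AL i j.
move=> H; suff : F (A @^-1` [set N | (L i j, N i j) \in B]) by [].
by apply: filterS H => t tL /=; rewrite inE; apply: eB.
Qed.

Lemma cvg_big_sum (I : Type) (r : seq I) (P : pred I) (f : I -> T -> R) (l : I -> R) :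
  (forall i, P i -> f i t @[t --> F] --> l i) ->
  (\sum_(i <- r | P i) f i t) @[t --> F] --> \sum_(i <- r | P i) l i.
Proof.
move=> fl; rewrite (_ : (fun t => _) = \sum_(i <- r | P i) f i); last first.
  by apply/funext => t; rewrite fct_sumE.
elim/big_rec2: _ => [|i y x Pi yx]; first exact: cvg_cst.
by apply: cvgD => //; exact: fl.
Qed.

Lemma cvg_big_prod (I : Type) (r : seq I) (P : pred I) (f : I -> T -> R) (l : I -> R) :
  (forall i, P i -> f i t @[t --> F] --> l i) ->
  (\prod_(i <- r | P i) f i t) @[t --> F] --> \prod_(i <- r | P i) l i.
Proof.
move=> fl; elim: r => [|i r IHr].
  by under eq_fun do rewrite big_nil; rewrite big_nil; exact: cvg_cst.
rewrite big_cons; under eq_fun do rewrite big_cons.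
by case: ifP => // Pi; apply: cvgM => //; exact: fl.
Qed.

Lemma mxcvg_cst m n (L : 'M[R]_(m, n)) : mxcvg (fun=> L) L.
Proof. by move=> i j; exact: cvg_cst. Qed.

Lemma mxcvg_mul m n p (A : T -> 'M[R]_(m, n)) (B : T -> 'M[R]_(n, p)) A0 B0 :
  mxcvg A A0 -> mxcvg B B0 -> mxcvg (fun t => A t *m B t) (A0 *m B0).
Proof.
move=> AA BB i j; under eq_fun do rewrite mxE; rewrite mxE.
by apply: cvg_big_sum => k _; apply: cvgM; [exact: AA|exact: BB].
Qed.

Lemma mxcvg_tr m n (A : T -> 'M[R]_(m, n)) A0 :
  mxcvg A A0 -> mxcvg (fun t => (A t)^T) A0^T.
Proof. by move=> AA i j; under eq_fun do rewrite mxE; rewrite mxE; exact: AA. Qed.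

Lemma mxcvgZ m n (s : R) (A : T -> 'M[R]_(m, n)) A0 :
  mxcvg A A0 -> mxcvg (fun t => s *: A t) (s *: A0).
Proof.
move=> AA i j; under eq_fun do rewrite mxE; rewrite mxE.
by apply: cvgM; [exact: cvg_cst|exact: AA].
Qed.

Lemma mxcvg_row m n p (A : T -> 'M[R]_(m, n)) (B : T -> 'M[R]_(m, p)) A0 B0 :
  mxcvg A A0 -> mxcvg B B0 -> mxcvg (fun t => row_mx (A t) (B t)) (row_mx A0 B0).
Proof.
move=> AA BB i j; under eq_fun do rewrite mxE; rewrite mxE.
by case: (fintype.split j) => k; [exact: AA|exact: BB].
Qed.

Lemma cvg_det n (A : T -> 'M[R]_n) A0 :
  mxcvg A A0 -> \det (A t) @[t --> F] --> \det A0.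
Proof.
move=> AA; apply: cvg_big_sum => s _; apply: cvgM; first exact: cvg_cst.
by apply: cvg_big_prod => i _; exact: AA.
Qed.

Lemma near_unitmx n (A : T -> 'M[R]_n) A0 :
  mxcvg A A0 -> A0 \in unitmx -> \forall t \near F, A t \in unitmx.
Proof.
move=> AA; rewrite unitmxE unitfE => d0.
have dn := cvgr_neq0 _ (cvg_det AA) d0.
near=> t; rewrite unitmxE unitfE; near: t; exact: dn.
Unshelve. all: by end_near.
Qed.

(** Cramer's rule: near the limit the entries of the inverse are cofactors divided by the
    determinant. *)
Lemma mxcvg_inv n (A : T -> 'M[R]_n) A0 :
  mxcvg A A0 -> A0 \in unitmx -> mxcvg (fun t => invmx (A t)) (invmx A0).
Proof.
move=> AA Au i j.
have Anear := near_unitmx AA Au.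
have E : forall B : 'M[R]_n, B \in unitmx ->
    invmx B i j = (\det B)^-1 * cofactor B j i.
  by move=> B Bu; rewrite /invmx Bu !mxE.
rewrite E //; apply: cvg_trans.
  apply: (near_eq_cvg (f := fun t => (\det (A t))^-1 * cofactor (A t) j i)).
  by apply: filterS Anear => t /E.
apply: cvgM; first apply: cvgV.
- by rewrite unitmxE unitfE in Au.
- exact: cvg_det.
apply: cvgM; first exact: cvg_cst.
apply: cvg_det => k l; under eq_fun do rewrite !mxE; rewrite !mxE; exact: AA.
Qed.

(** On a subspace of dimension [ind A0] the form of [A0] is at most [- k |v|^2]; a perturbation
    smaller than [k |v|^2] leaves [A t] negative there. *)
Lemma ind_lsc n (A : T -> 'M[R]_n) (A0 : 'M[R]_n) :
  A0^T = A0 -> (\forall t \near F, (A t)^T = A t) -> mxcvg A A0 ->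
  \forall t \near F, (ind A0 <= ind (A t))%N.
Proof.
move=> A0s As AA; have [U [k [k0 <- neg]]] := ind_neg A0s.
pose d := k / n.+1%:R; have d0 : 0 < d by rewrite divr_gt0 ?ltr0n.
(* When all entries of [A0 - A t] are below [d], its form is at most [d n |v|^2]; the denominator
   [n.+1] makes this strictly less than [k |v|^2]. *)
have near_d : \forall t \near F, forall i j, `|A0 i j - A t i j| < d.
  apply: filter_forall => i; apply: filter_forall => j.
  by have /cvgrPdist_lt/(_ _ d0) := AA i j.
near=> t.
have Ats : (A t)^T = A t by near: t.
have td : forall i j, `|A0 i j - A t i j| < d by near: t.
apply: ind_max => // v vU v0.
have vv := dotmx_gt0 v0.
have -> : v *m A t *m v^T = v *m A0 *m v^T - v *m (A0 - A t) *m v^T.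
  by rewrite mulmxBr mulmxBl opprB addrC subrK.
rewrite mxE [X in _ + X]mxE; apply: le_lt_trans (lerD (neg v vU) (ler_norm _)) _.
rewrite normrN addrC subr_lt0.
apply: (@le_lt_trans _ _ (d * n%:R * (v *m v^T) 0 0)); last first.
  by rewrite ltr_pM2r // /d mulrAC ltr_pdivrMr ?ltr0n // ltr_pM2l // ltr_nat.
rewrite mxE; apply: le_trans (ler_norm_sum _ _ _) _.
apply: (@le_trans _ _ (\sum_j \sum_i d * ((v 0 i ^+ 2 + v 0 j ^+ 2) / 2))).
  apply: ler_sum => j _; rewrite !mxE mulr_suml; apply: le_trans (ler_norm_sum _ _ _) _.
  apply: ler_sum => i _; rewrite !mxE !normrM mulrAC mulrC.
  apply: ler_pM; rewrite ?mulr_ge0 //; first exact/ltW/td.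
  rewrite ler_pdivlMr // -(real_normK (num_real (v 0 i))) -(real_normK (num_real (v 0 j))).
  have := sqr_ge0 (`|v 0 i| - `|v 0 j|); lra.
under eq_bigr do rewrite -mulr_sumr -mulr_suml big_split /= sumr_const card_ord.
rewrite -mulr_sumr -mulr_suml big_split /= sumr_const card_ord.
rewrite sumrMnl.
have -> : (v *m v^T) 0 0 = \sum_i v 0 i ^+ 2.
  by rewrite mxE; apply: eq_bigr => i _; rewrite mxE -expr2.
move: (\sum_i _) => q; rewrite -mulr_natl le_eqVlt; apply/orP; left; apply/eqP.
by field.
Unshelve. all: by end_near.
Qed.

(** The indices of [A] and [- A] are both lower semicontinuous and add up to the rank, which is
    locally constant, so neither can jump. *)
Lemma ind_near_cst n (A : T -> 'M[R]_n) (A0 : 'M[R]_n) :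
  A0^T = A0 -> (\forall t \near F, (A t)^T = A t) -> mxcvg A A0 ->
  (\forall t \near F, \rank (A t) = \rank A0) ->
  \forall t \near F, ind (A t) = ind A0.
Proof.
move=> A0s As AA rA.
have le1 := ind_lsc A0s As AA.
have le2 : \forall t \near F, (ind (- A0) <= ind (- A t))%N.
  apply: ind_lsc; first by rewrite linearN /= A0s.
    by near=> t; rewrite linearN /=; congr (- _); near: t.
  by have := mxcvgZ (s := - 1) AA; under eq_fun do rewrite scaleN1r; rewrite scaleN1r.
have le12 := filterI le1 le2.
near=> t.
have Ats : (A t)^T = A t by near: t.
have rAt : \rank (A t) = \rank A0 by near: t.
suff [le1t le2t] : (ind A0 <= ind (A t))%N /\ (ind (- A0) <= ind (- A t))%N.
  have := rank_ind Ats; rewrite rAt (rank_ind A0s) => /esym rE.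
  by apply/eqP; rewrite eqn_leq le1t andbT -(leq_add2r (ind (- A t))) rE leq_add2l.
by near: t; exact: le12.
Unshelve. all: by end_near.
Qed.

End MatrixLimits.

(** * Transversal planes and intervals *)

Section GraphPlanes.
Variables (R : realType) (n : nat).
Implicit Types A : 'M[R]_(n + n, n).

(** The graph of [x] times the identity: transverse to [E] for every [x], and to a given Lagrangian
    plane once [x] is large. *)
Definition graph_plane (x : R) : 'M[R]_(n + n, n) := col_mx 1%:M x%:M.

(** A symplectic matrix sending [E] to [graph_plane x]; admissible systems consist of such matrices
    rather than of planes. *)
Definition graph_symp (x : R) : 'M[R]_(n + n) := block_mx 0 1%:M (- 1%:M) x%:M.

Lemma graph_symp_symplectic x : symplectic (graph_symp x).
Proof.
rewrite /symplectic tr_block_mx linearN /= trmx0 !trmx1 tr_scalar_mx !mulmx_block.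
rewrite !(mulmx0, mul0mx, mulmx1, mul1mx, mulmxN, mulNmx, add0r, addr0, oppr0, opprK).
by rewrite addNr.
Qed.

Lemma graph_symp_E x : graph_symp x *m Emx n = graph_plane x.
Proof. by rewrite mul_block_col !(mulmx0, add0r, mulmx1). Qed.

Lemma graph_plane_lagrangian x : lagrangian_plane (graph_plane x).
Proof. by rewrite -graph_symp_E; apply/symplectic_lagrangian/lagrangian_E/graph_symp_symplectic. Qed.

Lemma wronskian_graph x A : wronskian (graph_plane x) A = dsubmx A - x *: usubmx A.
Proof.
rewrite /wronskian -[A in LHS]vsubmxK tr_col_mx mul_row_block mul_row_col.
rewrite !tr_scalar_mx !(mulmx0, mulmxN, mulmx1, add0r, addr0) mulNmx.
by rewrite mul_scalar_mx mul1mx addrC.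
Qed.

Lemma transverse_graph_E x : transverse (graph_plane x) (Emx n).
Proof. by rewrite /transverse wronskian_graph col_mxKu col_mxKd scaler0 subr0 unitmx1. Qed.

Lemma transverse_graph A : lagrangian_plane A ->
  exists M, forall x, M <= x -> transverse (graph_plane x) A.
Proof.
move=> [A0 rA]; pose X := usubmx A; pose U := dsubmx A.
(* The Lagrangian condition makes [(U - x X)^T (U + x X) = U^T U - x^2 X^T X],
   whose determinant is a nonzero polynomial in [y = - x^2] as [A^T A] is its
   argument at [y = 1]. *)
have UX : U^T *m X = X^T *m U.
  move: A0; rewrite -[A]vsubmxK tr_col_mx mul_row_block mul_row_col -/X -/U.
  rewrite !(mulmx0, mulmxN, mulmx1, add0r, addr0) mulNmx => /eqP.
  by rewrite addrC subr_eq0 => /eqP.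
pose g := \det (map_mx polyC (U^T *m U) + 'X *: map_mx polyC (X^T *m X)).
have gE y : g.[y] = \det (U^T *m U + y *: (X^T *m X)).
  rewrite -[LHS]/(horner_eval y g) /g -det_map_mx; congr (\det _).
  by apply/matrixP => i j; rewrite !mxE /= /horner_eval !hornerE.
have g0 : g != 0.
  have : g.[1] != 0.
    rewrite gE scale1r addrC -mul_row_col -tr_col_mx vsubmxK -unitfE -unitmxE.
    rewrite -{2}(trmxK A); apply: gram_unitmx; rewrite /row_free mxrank_tr rA eqxx //.
  by apply: contraNneq => ->; rewrite horner0.
(* The added 1 forces [x >= 1], so that [x ^+ 2 >= x] lies beyond the bound on the roots of [g]. *)
exists (cauchy_bound g + 1) => x gx.
have x1 : 1 <= x by apply: le_trans gx; rewrite lerDr cauchy_bound_ge0.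
rewrite /transverse wronskian_graph -/X -/U.
have : U^T *m U + (- (x ^+ 2)) *: (X^T *m X) = (U - x *: X)^T *m (U + x *: X).
  rewrite linearB /= [(x *: X)^T]linearZ /= mulmxBl !mulmxDr -!scalemxAl -!scalemxAr scalerA UX.
  by rewrite opprD addrA addrK expr2 scaleNr.
move=> /(congr1 determinant); rewrite -gE det_mulmx det_tr unitmxE unitfE => gM.
have : g.[- (x ^+ 2)] != 0.
  apply/negP => /eqP /(cauchy_boundP g0).
  rewrite normrN ger0_norm ?sqr_ge0 // ltNge => /negP[]; apply: (le_trans _ (_ : x <= _)).
    by apply: le_trans gx; rewrite lerDl.
  by rewrite expr2 ler_peMr // (le_trans ler01).
by rewrite gM; apply: contraNneq => ->; rewrite mul0r.
Qed.

End GraphPlanes.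

(** * Neighbourhoods in a closed interval and continuous induction *)

Section IntervalInduction.
Variable R : realType.

Definition nbhs_itv (a b t0 : R) : set_system R := within `[a, b]%classic (nbhs t0).

Global Instance nbhs_itv_filter a b t0 : Filter (nbhs_itv a b t0).
Proof. by apply: within_filter. Qed.

Lemma near_itvP a b t0 (P : R -> Prop) :
  (\forall t \near nbhs_itv a b t0, P t) <->
  exists2 e, 0 < e & forall t, a <= t <= b -> `|t - t0| < e -> P t.
Proof.
rewrite /nbhs_itv near_withinE; split.
  move=> /nbhs_ballP[e /= e0 eP]; exists e => // t tab te; apply: eP => /=.
    by rewrite -ball_normE /= distrC.
  by rewrite in_itv.
move=> [e e0 eP]; apply/nbhs_ballP; exists e => //= t; rewrite -ball_normE /= => te.
by rewrite in_itv /= => tab; apply: eP => //; rewrite distrC.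
Qed.

(** Let [S] be the set of points where [Q] holds. A step from a point of [S] close to [sup S] passes
    beyond the supremum, unless that is [b]. *)
Lemma itv_induction (a b : R) (Q : R -> Prop) : a <= b -> Q a ->
  (forall t0, a <= t0 <= b -> exists2 e, 0 < e & forall c d,
     a <= c -> c < d -> d <= b -> `|c - t0| < e -> `|d - t0| < e -> Q c -> Q d) ->
  Q b.
Proof.
move=> ab Qa step; pose S : set R := [set x | a <= x <= b /\ Q x].
have Sa : S a by split; rewrite ?lexx.
have Ssup : has_sup S by split; [exists a|exists b => x [/andP[]]].
have aS : a <= sup S by apply: sup_upper_bound.
have Sb : sup S <= b by apply: ge_sup; [exists a|move=> x [/andP[]]].
have [|e e0 eQ] := step (sup S); first by rewrite aS.
have [c [/andP[ac cb] Qc] cS] := sup_adherent e0 Ssup.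
have cS' : c <= sup S by apply: sup_upper_bound => //; split => //; rewrite ac.
pose d := Num.min b (sup S + e / 2).
have Sd : sup S <= d by rewrite le_min Sb lerDl divr_ge0 ?ltW.
have db : d <= b by rewrite ge_min lexx.
have dS : d <= sup S + e / 2 by rewrite ge_min lexx orbT.
have Qd : Q d.
  have := le_trans cS' Sd; rewrite le_eqVlt => /orP[/eqP <- //|cd].
  apply: (eQ c) => //; first by rewrite ler0_norm ?subr_le0 //; lra.
  by rewrite ger0_norm ?subr_ge0 //; lra.
have : d <= sup S by apply: sup_upper_bound => //; split => //; rewrite db (le_trans ac) // (le_trans cS').
rewrite ge_min => /orP[bS|]; last by lra.
by have <- : d = b by apply/eqP; rewrite eq_le db (le_trans bS).
Qed.

Lemma near_const_itv (V : Type) (a b : R) (f : R -> V) : a <= b ->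
  (forall t0, a <= t0 <= b -> \forall t \near nbhs_itv a b t0, f t = f t0) ->
  f b = f a.
Proof.
move=> ab fc; apply: (itv_induction (Q := fun d => f d = f a) ab) => // t0 t0ab.
have /near_itvP[e e0 ef] := fc _ t0ab; exists e => // c d ac cd db ce de <-.
rewrite [LHS]ef ?[RHS]ef //; first by rewrite ac (le_trans (ltW cd)).
by rewrite db (le_trans ac) // ltW.
Qed.

End IntervalInduction.

(** * Primitives of the oscillation number *)

HB.lock Definition ind_Delta (R : realType) (n : nat) (s : R)
    (T Y Q : R -> 'M[R]_(n + n, n)) (t : R) : nat :=
  ind (s *: Delta (T t) (Y t) (Q t)).

Section Primitives.
Variables (R : realType) (n : nat) (s : R).
Hypothesis s0 : s != 0.
Implicit Types (a b t : R) (Y T Q : R -> 'M[R]_(n + n, n)).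

Local Notation E := (Emx n).

Definition path_on a b T : Prop :=
  forall t, a <= t <= b -> lagrangian_plane (T t) /\ mxcvg (nbhs_itv a b t) T (T t).

Lemma lagrangian_pathP a b T : lagrangian_path a b T <-> path_on a b T.
Proof.
split=> [[/subspace_continuousP cT lT] t tab|pT].
  by split; [exact: lT|apply/mxcvgP; apply: cT; rewrite /= in_itv].
split; last by move=> t /pT[].
apply/subspace_continuousP => t /=; rewrite in_itv /= => tab.
by apply/mxcvgP; have [] := pT t tab.
Qed.

Lemma path_on_sub a b c d T : a <= c -> d <= b -> path_on a b T -> path_on c d T.
Proof.
move=> ac db pT t /andP[ct td].
have [|lT cT] := pT t; first by rewrite (le_trans ac) // (le_trans td).
split=> // i j; apply: cvg_trans (cT i j); apply: cvg_app.
apply: within_subset => u /=; rewrite !in_itv /= => /andP[cu ud].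
by rewrite (le_trans ac) // (le_trans ud).
Qed.

Lemma path_on_cst a b A : lagrangian_plane A -> path_on a b (fun=> A).
Proof. by move=> LA t _; split=> //; exact: mxcvg_cst. Qed.

Local Notation ind_Delta := (ind_Delta s).

Lemma near_transverse a b t0 T Y : a <= t0 <= b -> path_on a b T -> path_on a b Y ->
  transverse (T t0) (Y t0) -> \forall t \near nbhs_itv a b t0, transverse (T t) (Y t).
Proof.
move=> tab pT pY; apply: near_unitmx; apply: mxcvg_mul; last by have [] := pY _ tab.
apply: mxcvg_mul; last exact: mxcvg_cst.
by apply: mxcvg_tr; have [] := pT _ tab.
Qed.

Lemma near_itv_mem a b t0 : \forall t \near nbhs_itv a b t0, a <= t <= b.
Proof. by apply/near_itvP; exists 1. Qed.

Lemma mxcvg_Delta a b t0 T Y Q : a <= t0 <= b ->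
  path_on a b T -> path_on a b Y -> path_on a b Q ->
  transverse (T t0) (Y t0) -> transverse (T t0) (Q t0) ->
  mxcvg (nbhs_itv a b t0) (fun t => Delta (T t) (Y t) (Q t))
    (Delta (T t0) (Y t0) (Q t0)).
Proof.
move=> tab /(_ _ tab)[_ cT] /(_ _ tab)[_ cY] /(_ _ tab)[_ cQ] TY TQ.
have cW (A B : R -> 'M[R]_(n + n, n)) (A0 B0 : 'M[R]_(n + n, n)) :
    mxcvg (nbhs_itv a b t0) A A0 -> mxcvg (nbhs_itv a b t0) B B0 ->
    mxcvg (nbhs_itv a b t0) (fun t => wronskian (A t) (B t)) (wronskian A0 B0).
  by move=> cA cB; apply: mxcvg_mul => //; apply: mxcvg_mul; [exact: mxcvg_tr|exact: mxcvg_cst].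
apply: mxcvg_mul; last by apply: mxcvg_inv => //; exact: cW.
apply: mxcvg_mul; last exact: cW.
by apply: mxcvg_tr; apply: mxcvg_inv => //; exact: cW.
Qed.

(** [Delta] is continuous at [t0] and has the rank of the Wronskian, so a locally constant rank
    makes the index locally constant. *)
Lemma ind_Delta_near a b t0 T Y Q : a <= t0 <= b ->
  path_on a b T -> path_on a b Y -> path_on a b Q ->
  transverse (T t0) (Y t0) -> transverse (T t0) (Q t0) ->
  (\forall t \near nbhs_itv a b t0,
     \rank (wronskian (Y t) (Q t)) = \rank (wronskian (Y t0) (Q t0))) ->
  \forall t \near nbhs_itv a b t0, ind_Delta T Y Q t = ind_Delta T Y Q t0.
Proof.
move=> tab pT pY pQ TY TQ rk.
have nTY := near_transverse tab pT pY TY; have nTQ := near_transverse tab pT pQ TQ.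
have nab := near_itv_mem a b t0.
have sym t : a <= t <= b -> transverse (T t) (Y t) -> transverse (T t) (Q t) ->
    (s *: Delta (T t) (Y t) (Q t))^T = s *: Delta (T t) (Y t) (Q t).
  move=> {}tab TYt TQt; rewrite linearZ /= Delta_sym //.
  - by have [] := pT _ tab.
  - by have [] := pY _ tab.
  - by have [] := pQ _ tab.
suff H : \forall t \near nbhs_itv a b t0,
    ind (s *: Delta (T t) (Y t) (Q t)) = ind (s *: Delta (T t0) (Y t0) (Q t0)).
  by near=> t; rewrite !ind_Delta.unlock; near: t; exact: H.
apply: (ind_near_cst (A := fun t => s *: Delta (T t) (Y t) (Q t))).
- exact: sym.
- near=> t; have tab' : a <= t <= b by near: t.
  have TYt : transverse (T t) (Y t) by near: t.
  have TQt : transverse (T t) (Q t) by near: t.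
  exact: sym.
- by apply: mxcvgZ; apply: mxcvg_Delta.
- near=> t; have TYt : transverse (T t) (Y t) by near: t.
  have TQt : transverse (T t) (Q t) by near: t.
  by rewrite !mxrank_scale_nz // !Delta_rank //; near: t.
Unshelve. all: by end_near.
Qed.

(* On a segment where [T] stays transverse to [Y] and [E], a primitive has the
   increments of [- ind_Delta T Y E]; these do not depend on [T]. *)
Definition primitive a b Y (G : R -> int) : Prop :=
  forall t0, a <= t0 <= b -> forall T, path_on a b T ->
  transverse (T t0) (Y t0) -> transverse (T t0) E ->
  \forall t \near nbhs_itv a b t0,
    G t + (ind_Delta T Y (fun=> E) t)%:Z = G t0 + (ind_Delta T Y (fun=> E) t0)%:Z.

(** In the formula of [mu_signed_Delta] the two indices on the right are locally constant, by the
    two rank hypotheses. *)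
Lemma mu_signed_near a b t0 Y Q T : a <= t0 <= b ->
  path_on a b Y -> path_on a b Q -> path_on a b T ->
  transverse (T t0) (Y t0) -> transverse (T t0) (Q t0) -> transverse (T t0) E ->
  (\forall t \near nbhs_itv a b t0,
     \rank (wronskian (Y t) (Q t)) = \rank (wronskian (Y t0) (Q t0))) ->
  (\forall t \near nbhs_itv a b t0,
     \rank (wronskian (Q t) E) = \rank (wronskian (Q t0) E)) ->
  \forall t \near nbhs_itv a b t0,
    (mu_signed s (Y t) (Q t) + ind_Delta T Y (fun=> E) t)%N =
    (mu_signed s (Y t0) (Q t0) + ind_Delta T Y (fun=> E) t0)%N.
Proof.
move=> tab pY pQ pT TY TQ TE rYQ rQE.
have pE : path_on a b (fun=> E) by exact/path_on_cst/lagrangian_E.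
have nTY := near_transverse tab pT pY TY; have nTQ := near_transverse tab pT pQ TQ.
have nTE := near_transverse tab pT pE TE; have nab := near_itv_mem a b t0.
have c1 := ind_Delta_near tab pT pY pQ TY TQ rYQ.
have c2 := ind_Delta_near tab pT pQ pE TQ TE rQE.
have key t : a <= t <= b -> transverse (T t) (Y t) -> transverse (T t) (Q t) -> transverse (T t) E ->
    (mu_signed s (Y t) (Q t) + ind_Delta T Y (fun=> E) t = ind_Delta T Y Q t + ind_Delta T Q (fun=> E) t)%N.
  move=> {}tab TYt TQt TEt; rewrite !ind_Delta.unlock; apply: mu_signed_Delta => //.
  - by have [] := pT _ tab.
  - by have [] := pY _ tab.
  - by have [] := pQ _ tab.
near=> t.
have [e1 e2] : ind_Delta T Y Q t = ind_Delta T Y Q t0 /\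
    ind_Delta T Q (fun=> E) t = ind_Delta T Q (fun=> E) t0.
  by near: t; exact: filterI c1 c2.
have tab' : a <= t <= b by near: t.
have TYt : transverse (T t) (Y t) by near: t.
have TQt : transverse (T t) (Q t) by near: t.
have TEt : transverse (T t) E by near: t.
have k1 := key t tab' TYt TQt TEt; have k0 := key t0 tab TY TQ TE.
exact (etrans k1 (etrans (congr2 addn e1 e2) (esym k0))).
Unshelve. all: by end_near.
Qed.

Lemma transfer_increment (m m' q q' x x' y y' : nat) :
  (m + x = m' + x' /\ (q + x = q' + x' /\ q + y = q' + y'))%N ->
  m%:Z + y%:Z = m'%:Z + y'%:Z.
Proof. by lia. Qed.

(** The given [T] need not be transverse to [Q t0]. A plane [X] transverse to [Y t0], [Q t0] and [E]
    gives the increment in terms of [X], and an auxiliary plane [Z] transverse to [Y t0], [X] and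
    [T t0] shows that the indices for [X] and for [T] have the same increments. *)
Lemma primitive_mu_signed a b Y Q : path_on a b Y -> path_on a b Q ->
  (forall t t', a <= t <= b -> a <= t' <= b ->
     \rank (wronskian (Y t) (Q t)) = \rank (wronskian (Y t') (Q t'))) ->
  (forall t t', a <= t <= b -> a <= t' <= b ->
     \rank (wronskian (Q t) E) = \rank (wronskian (Q t') E)) ->
  primitive a b Y (fun t => (mu_signed s (Y t) (Q t))%:Z).
Proof.
move=> pY pQ rYQ rQE t0 tab T pT TY TE.
have nab := near_itv_mem a b t0.
have [lY _] := pY _ tab; have [lQ _] := pQ _ tab; have [lT _] := pT _ tab.
have [M1 tY] := transverse_graph lY; have [M2 tQ] := transverse_graph lQ.
have [M3 tT] := transverse_graph lT.
pose x := Num.max M1 (Num.max M2 M3).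
have [xY xQ xT] : [/\ M1 <= x, M2 <= x & M3 <= x] by rewrite !le_max !lexx !orbT.
have [M4 tx] := transverse_graph (graph_plane_lagrangian n x).
pose y := Num.max M1 (Num.max M3 M4).
have [yY yT yx] : [/\ M1 <= y, M3 <= y & M4 <= y] by rewrite !le_max !lexx !orbT.
pose X (t : R) := graph_plane n x; pose Z (t : R) := graph_plane n y.
have pX : path_on a b X by exact/path_on_cst/graph_plane_lagrangian.
have pZ : path_on a b Z by exact/path_on_cst/graph_plane_lagrangian.
have trC (A B : 'M[R]_(n + n, n)) : transverse A B -> transverse B A.
  move=> AB; rewrite /transverse -unitmx_tr tr_wronskian -scaleN1r unitmxZ //.
  by rewrite unitrN1.
have rank_tr (A B : 'M[R]_(n + n, n)) : transverse A B -> \rank (wronskian A B) = n by move=> AB; apply: mxrank_unit.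
have rZ : \forall t \near nbhs_itv a b t0,
     \rank (wronskian (Y t) (Z t)) = \rank (wronskian (Y t0) (Z t0)).
  have nZY := near_transverse tab pZ pY (tY _ yY).
  near=> t; have ZY : transverse (Z t) (Y t) by near: t.
  by rewrite !rank_tr //; apply: trC => //; exact: tY.
have c1 : \forall t \near nbhs_itv a b t0,
    (mu_signed s (Y t) (Q t) + ind_Delta X Y (fun=> E) t)%N =
    (mu_signed s (Y t0) (Q t0) + ind_Delta X Y (fun=> E) t0)%N.
  apply: mu_signed_near => //; [exact: tY|exact: tQ|exact: transverse_graph_E| | ].
    near=> t; have tab' : a <= t <= b by near: t.
    exact: rYQ.
  near=> t; have tab' : a <= t <= b by near: t.
  exact: rQE.
have c2 : \forall t \near nbhs_itv a b t0,
    (mu_signed s (Y t) (Z t) + ind_Delta X Y (fun=> E) t)%N =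
    (mu_signed s (Y t0) (Z t0) + ind_Delta X Y (fun=> E) t0)%N.
  apply: mu_signed_near => //; [exact: tY| |exact: transverse_graph_E|exact: nearW].
  by apply: trC; exact: tx.
have c3 : \forall t \near nbhs_itv a b t0,
    (mu_signed s (Y t) (Z t) + ind_Delta T Y (fun=> E) t)%N =
    (mu_signed s (Y t0) (Z t0) + ind_Delta T Y (fun=> E) t0)%N.
  apply: mu_signed_near => //; [ |exact: nearW].
  by apply: trC; exact: tT.
have c123 := filterI c1 (filterI c2 c3).
near=> t.
apply: (transfer_increment (q := mu_signed s (Y t) (Z t)) (q' := mu_signed s (Y t0) (Z t0))
  (x := ind_Delta X Y (fun=> E) t) (x' := ind_Delta X Y (fun=> E) t0)).
near: t; exact: c123.
Unshelve. all: by end_near.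
Qed.

Lemma shift_increment (k k' g g' c d d' : int) :
  k = g - c -> k' = g' - c -> g + d = g' + d' -> k + d = k' + d'.
Proof. by lia. Qed.

Lemma primitive_glue a c b Y (G H : R -> int) : a <= c -> c <= b ->
  primitive a c Y G -> primitive c b Y H ->
  exists K, primitive a b Y K /\ K b - K a = (G c - G a) + (H b - H c).
Proof.
(* [G] and [H] are shifted to vanish at [c], so the two branches agree there. *)
move=> ac cb pG pH; pose K t := if t <= c then G t - G c else H t - H c.
have KG t : t <= c -> K t = G t - G c by rewrite /K => ->.
have KH t : c <= t -> K t = H t - H c.
  by rewrite /K le_eqVlt => /orP[/eqP <-|]; [rewrite lexx !subrr|case: leP].
exists K; split; last by rewrite (KG a) // (KH b) //; ring.
move=> t0 /andP[at0 t0b] T pT TY TE; apply/near_itvP.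
have [e e0 eG] : exists2 e, 0 < e & forall t, a <= t <= c -> `|t - t0| < e ->
    K t + (ind_Delta T Y (fun=> E) t)%:Z = K t0 + (ind_Delta T Y (fun=> E) t0)%:Z.
  case: (leP t0 c) => t0c; last first.
    exists (t0 - c); first by rewrite subr_gt0.
    by move=> t /andP[_ tc]; rewrite ltr_norml => /andP[? _]; exfalso; lra.
  have t0ac : a <= t0 <= c by rewrite at0.
  have pT' : path_on a c T by exact: path_on_sub pT.
  have /near_itvP[e e0 eG] := pG t0 t0ac T pT' TY TE.
  exists e; first exact: e0.
  move=> t tac te; have /andP[_ tc] := tac.
  exact: shift_increment (KG t tc) (KG t0 t0c) (eG t tac te).
have [f f0 fH] : exists2 e, 0 < e & forall t, c <= t <= b -> `|t - t0| < e ->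
    K t + (ind_Delta T Y (fun=> E) t)%:Z = K t0 + (ind_Delta T Y (fun=> E) t0)%:Z.
  case: (leP c t0) => t0c; last first.
    exists (c - t0); first by rewrite subr_gt0.
    by move=> t /andP[tc _]; rewrite ltr_norml => /andP[_ ?]; exfalso; lra.
  have t0cb : c <= t0 <= b by rewrite t0c.
  have pT' : path_on c b T by exact: path_on_sub pT.
  have /near_itvP[e' e0' eH] := pH t0 t0cb T pT' TY TE.
  exists e'; first exact: e0'.
  move=> t tcb te; have /andP[ct _] := tcb.
  exact: shift_increment (KH t ct) (KH t0 t0c) (eH t tcb te).
exists (Num.min e f); first by rewrite lt_min e0.
move=> t /andP[at_ tb]; rewrite lt_min => /andP[te tf].
by case: (leP t c) => tc; [apply: eG|apply: fH]; rewrite ?at_ ?tb ?tc ?(ltW tc).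
Qed.

Lemma rank_wronskianC (A B : 'M[R]_(n + n, n)) :
  \rank (wronskian A B) = \rank (wronskian B A).
Proof. by rewrite -mxrank_tr tr_wronskian mxrank_opp. Qed.

Lemma row10_mul (A : 'M[R]_(n + n, n)) :
  (row_mx 1%:M 0 : 'M[R]_(n, n + n)) *m A = usubmx A.
Proof. by rewrite -[A in LHS]vsubmxK mul_row_col mul1mx mul0mx addr0. Qed.

(** On each subinterval the comparative index with [S k u *m E] is a primitive, since admissibility
    makes the two relevant ranks constant. These primitives are glued one after another. *)
Lemma osc_system_primitive a b Y p (t : nat -> R) (S : nat -> R -> 'M[R]_(n + n)) :
  path_on a b Y -> osc_system a b Y p t S ->
  exists G, primitive a b Y G /\
    G b - G a = \sum_(k < p) ((mu_signed s (Y (t k.+1)) (S k (t k.+1) *m E))%:Z -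
                              (mu_signed s (Y (t k)) (S k (t k) *m E))%:Z).
Proof.
move=> pY [ta tb tlt tS].
have tle k : (k <= p)%N -> a <= t k.
  elim: k => [|k IHk] kp; first by rewrite ta.
  by rewrite (le_trans (IHk (ltnW kp))) // ltW // tlt.
have tleb k : (k <= p)%N -> t k <= b.
  elim: {k}(p - k)%N {-2}k (erefl (p - k)%N) => [|m IHm] k pk kp.
    by rewrite -tb (_ : k = p) //; lia.
  have kp' : (k < p)%N by lia.
  by apply: le_trans (ltW (tlt _ kp')) _; apply: IHm; lia.
suff: forall q, (q <= p)%N -> exists G, primitive a (t q) Y G /\
    G (t q) - G a = \sum_(k < q) ((mu_signed s (Y (t k.+1)) (S k (t k.+1) *m E))%:Z -
                              (mu_signed s (Y (t k)) (S k (t k) *m E))%:Z).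
  by move=> /(_ p (leqnn p)); rewrite tb.
elim=> [|q IHq] qp.
  (* On the degenerate interval [[a, a]] every function is a primitive. *)
  rewrite ta big_ord0; exists (fun=> 0); split; last by rewrite subrr.
  move=> t0 t0a T _ _ _; apply/near_itvP; exists 1 => // t' ta' _.
  by have -> : t' = t0 by apply/le_anti; move: t0a ta'; lra.
have [G [pG GE]] := IHq (ltnW qp).
have [cS sS rS rE] := tS q qp.
have tq : t q <= t q.+1 by rewrite ltW ?tlt.
have pQ : path_on (t q) (t q.+1) (fun u => S q u *m E).
  move=> u tu; split; first exact/symplectic_lagrangian/lagrangian_E/sS.
  apply: mxcvg_mul; last exact: mxcvg_cst.
  by apply/mxcvgP; move/subspace_continuousP : cS; apply; rewrite /= in_itv.
have pq : primitive (t q) (t q.+1) Y (fun u => (mu_signed s (Y u) (S q u *m E))%:Z).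
  apply: primitive_mu_signed => //.
  - by apply: path_on_sub pY; [apply: tle; exact: ltnW|exact: tleb].
  - move=> u u' tu tu'; have := rS u u' tu tu'.
    by rewrite -!(rank_wronskianC (Y _)).
  - move=> u u' tu tu'; have := rE u u' tu tu'.
    by rewrite !wronskian_E !mxrank_tr -!mulmxA !row10_mul.
have [K [pK KE]] := primitive_glue (tle _ (ltnW qp)) tq pG pq.
by exists K; split=> //; rewrite KE GE big_ord_recr.
Qed.

(** A graph plane transverse to [Y t0] stays transverse nearby, so the constant matrix
    [graph_symp n M] is admissible on short intervals near [t0]; induction along [[a, b]] appends
    such intervals. *)
Lemma osc_system_exists a b Y : a < b -> path_on a b Y ->
  exists p (t : nat -> R) (S : nat -> R -> 'M[R]_(n + n)), osc_system a b Y p t S.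
Proof.
move=> ab pY.
apply: (itv_induction (Q := fun d => exists p (t : nat -> R)
  (S : nat -> R -> 'M[R]_(n + n)), osc_system a d Y p t S) (ltW ab)).
  by exists 0%N, (fun=> a), (fun _ _ => 0); split.
move=> t0 tab; have [lY _] := pY _ tab; have [M tY] := transverse_graph lY.
pose X (t : R) := graph_plane n M.
have pX : path_on a b X by exact/path_on_cst/graph_plane_lagrangian.
have /near_itvP[e e0 eX] := near_transverse tab pX pY (tY M (lexx M)).
exists e => // c d ac cd db ce de [p [t [S [ta tc tlt tS]]]].
exists p.+1, (fun k => if (k <= p)%N then t k else d),
  (fun k => if (k < p)%N then S k else fun=> graph_symp n M); split.
- by rewrite leq0n.
- by rewrite ltnn.
- move=> k; rewrite ltnS => kp; rewrite kp; case: ltnP => kp'; first exact: tlt.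
  have -> : k = p by apply/eqP; rewrite eqn_leq kp kp'.
  by rewrite tc.
move=> k; rewrite ltnS => kp; rewrite kp; case: ltnP => kp'; first exact: tS.
have -> : k = p by apply/eqP; rewrite eqn_leq kp kp'.
rewrite tc graph_symp_E; split.
- exact: cst_continuous.
- by move=> *; exact: graph_symp_symplectic.
- have tr u : c <= u <= d -> \rank (wronskian (graph_plane n M) (Y u)) = n.
    move=> /andP[cu ud]; apply: mxrank_unit; apply: (eX u).
      by rewrite (le_trans ac) // (le_trans ud).
    by move: ce de; rewrite !ltr_norml; lra.
  by move=> u u' cu cu'; rewrite !tr.
- by [].
Qed.

End Primitives.

(** * Comparison of two paths *)

Section Comparison.
Variables (R : realType) (n : nat).
Implicit Types (a b : R) (Y T Q : R -> 'M[R]_(n + n, n)).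

Local Notation E := (Emx n).

Lemma symplectic_inv (Z : 'M[R]_(n + n)) : symplectic Z -> symplectic (invmx Z).
Proof.
move=> Zs; have Zu := symplectic_unit Zs.
rewrite /symplectic -{1}Zs !mulmxA -trmx_mul mulmxV // trmx1 mul1mx.
by rewrite -mulmxA mulmxV // mulmx1.
Qed.

(** The [g] are values of the primitives of [Y], [Yh] and [invmx Z *m Y], the [d] the indices that
    they compensate, and [m] is the comparative index. *)
Lemma comparison_increment (g1 g1' g2 g2' g3 g3' : int) (d1 d1' d2 d2' d3 d3' m m' : nat) :
  g1 + d1%:Z = g1' + d1'%:Z -> g2 + d2%:Z = g2' + d2'%:Z -> g3 + d3%:Z = g3' + d3'%:Z ->
  (m + d1 = d3 + d2)%N -> (m' + d1' = d3' + d2')%N ->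
  g1 - g2 - g3 - m%:Z = g1' - g2' - g3' - m'%:Z.
Proof. by lia. Qed.

Lemma path_on_symplectic a b Z Y : path_on a b Y ->
  (forall t, a <= t <= b -> symplectic (Z t) /\ mxcvg (nbhs_itv a b t) Z (Z t)) ->
  path_on a b (fun t => Z t *m Y t).
Proof.
move=> pY pZ t tab; have [lY cY] := pY t tab; have [sZ cZ] := pZ t tab.
by split; [exact: symplectic_lagrangian|exact: mxcvg_mul].
Qed.

(** [G1 - G2 - G3 - mu] is locally constant: near [t0] each primitive compensates an index, and
    [mu_signed_Delta] for the moving plane [T t = Z t *m X t] relates these three indices to
    [mu]. *)
Lemma primitive_compare (s : R) a b Y Yh (Z : R -> 'M[R]_(n + n)) (K : R -> 'M[R]_n)
    (G1 G2 G3 : R -> int) :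
  s != 0 -> a <= b -> path_on a b Y -> path_on a b Yh ->
  (forall t, a <= t <= b -> symplectic (Z t) /\ mxcvg (nbhs_itv a b t) Z (Z t)) ->
  (forall t, a <= t <= b -> K t \in unitmx /\ Z t *m E = Yh t *m K t) ->
  primitive s a b Y G1 -> primitive s a b Yh G2 ->
  primitive s a b (fun t => invmx (Z t) *m Y t) G3 ->
  (G1 b - G1 a) - (G2 b - G2 a) =
  (mu_signed s (Y b) (Yh b))%:Z - (mu_signed s (Y a) (Yh a))%:Z + (G3 b - G3 a).
Proof.
move=> s0 ab pY pYh pZ ZE prim1 prim2 prim3.
suff : forall t0, a <= t0 <= b -> \forall t \near nbhs_itv a b t0,
    G1 t - G2 t - G3 t - (mu_signed s (Y t) (Yh t))%:Z =
    G1 t0 - G2 t0 - G3 t0 - (mu_signed s (Y t0) (Yh t0))%:Z.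
  move=> /(near_const_itv (f := fun t => G1 t - G2 t - G3 t - (mu_signed s (Y t) (Yh t))%:Z) ab).
  by move: (mu_signed _ _ _) (mu_signed _ _ _) => m m'; lia.
move=> t0 tab.
pose P t := invmx (Z t) *m Y t.
have pP : path_on a b P.
  apply: path_on_symplectic => // t {}tab; have [sZ cZ] := pZ t tab.
  by split; [exact: symplectic_inv|apply: mxcvg_inv => //; exact: symplectic_unit].
have [sZ0 _] := pZ _ tab; have [lP _] := pP _ tab.
have lZE := symplectic_lagrangian (symplectic_inv sZ0) (lagrangian_E R n).
have [M1 tP] := transverse_graph lP; have [M2 tE] := transverse_graph lZE.
(* A large [x] makes [X] transverse to [invmx (Z t0) *m Y t0] and [invmx (Z t0) *m E], that is,
   [T t0] transverse to [Y t0] and [E]. *)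
pose x := Num.max M1 M2; have x1 : M1 <= x by rewrite le_max lexx.
have x2 : M2 <= x by rewrite le_max lexx orbT.
pose X (t : R) := graph_plane n x; pose T t := Z t *m X t.
have pX : path_on a b X by exact/path_on_cst/graph_plane_lagrangian.
have pT : path_on a b T by exact: path_on_symplectic.
have ZK t : a <= t <= b -> Z t *m (invmx (Z t) *m Y t) = Y t.
  by move=> {}tab; rewrite mulKVmx // symplectic_unit //; have [] := pZ _ tab.
have TY0 : transverse (T t0) (Y t0).
  by rewrite -(ZK _ tab) /transverse wronskian_symplectic //; exact: tP.
have TE0 : transverse (T t0) E.
  rewrite /transverse -[E](mulKVmx (symplectic_unit sZ0)) wronskian_symplectic //.
  exact: tE.
have TYh t : a <= t <= b -> transverse (T t) (Yh t).
  move=> {}tab; have [Ku ZEK] := ZE t tab; have [sZ _] := pZ t tab.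
  have : wronskian (T t) (Yh t *m K t) \in unitmx.
    rewrite -ZEK wronskian_symplectic //; exact: transverse_graph_E.
  by rewrite /wronskian mulmxA unitmx_mul => /andP[].
(* Symplectic invariance moves [X], [P], [E] to [T], [Y], [Z *m E], and the last spans the same
   plane as [Yh]. *)
have dE t : a <= t <= b -> ind_Delta s X P (fun=> E) t = ind_Delta s T Y Yh t.
  move=> {}tab; have [Ku ZEK] := ZE t tab; have [sZ _] := pZ t tab.
  rewrite !ind_Delta.unlock; congr (ind (s *: _)).
  rewrite -(Delta_symplectic (X t) (P t) E sZ) ZK // ZEK.
  by apply: Delta_mulr => //; exact: TYh.
have c1 := prim1 t0 tab T pT TY0 TE0.
have c2 := prim2 t0 tab T pT (TYh _ tab) TE0.
have c3 := prim3 t0 tab X pX (tP _ x1) (transverse_graph_E n x).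
have nTY := near_transverse tab pT pY TY0.
have pE : path_on a b (fun=> E) by exact/path_on_cst/lagrangian_E.
have nTE := near_transverse tab pT pE TE0; have nab := near_itv_mem a b t0.
have key t : a <= t <= b -> transverse (T t) (Y t) -> transverse (T t) E ->
    (mu_signed s (Y t) (Yh t) + ind_Delta s T Y (fun=> E) t =
     ind_Delta s X P (fun=> E) t + ind_Delta s T Yh (fun=> E) t)%N.
  move=> {}tab TYt TEt; rewrite dE // !ind_Delta.unlock; apply: mu_signed_Delta => //.
  - by have [] := pT _ tab.
  - by have [] := pY _ tab.
  - by have [] := pYh _ tab.
  - exact: TYh.
have k0 := key t0 tab TY0 TE0.
have kt : \forall t \near nbhs_itv a b t0,
    (mu_signed s (Y t) (Yh t) + ind_Delta s T Y (fun=> E) t =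
     ind_Delta s X P (fun=> E) t + ind_Delta s T Yh (fun=> E) t)%N.
  near=> t; have tab' : a <= t <= b by near: t.
  have TYt : transverse (T t) (Y t) by near: t.
  have TEt : transverse (T t) E by near: t.
  exact: key.
near=> t.
have c1t : G1 t + (ind_Delta s T Y (fun=> E) t)%:Z = G1 t0 + (ind_Delta s T Y (fun=> E) t0)%:Z.
  by near: t; exact: c1.
have c2t : G2 t + (ind_Delta s T Yh (fun=> E) t)%:Z = G2 t0 + (ind_Delta s T Yh (fun=> E) t0)%:Z.
  by near: t; exact: c2.
have c3t : G3 t + (ind_Delta s X P (fun=> E) t)%:Z = G3 t0 + (ind_Delta s X P (fun=> E) t0)%:Z.
  by near: t; exact: c3.
apply: comparison_increment c1t c2t c3t _ k0.
by near: t; exact: kt.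
Unshelve. all: by end_near.
Qed.

Lemma muE (A B : 'M[R]_(n + n, n)) : mu A B = mu_signed 1 A B.
Proof. by rewrite mu_signed.unlock scale1r. Qed.

Lemma mu_dualE (A B : 'M[R]_(n + n, n)) : mu_dual A B = mu_signed (-1) A B.
Proof. by rewrite mu_signed.unlock scaleN1r. Qed.

(** The set in [osc] is nonempty, and whichever admissible system the choice yields, its sum is the
    increment of a primitive. *)
Lemma osc_primitive a b Y : a < b -> path_on a b Y ->
  exists G, primitive 1 a b Y G /\ osc a b Y = G b - G a.
Proof.
move=> ab pY; have [p [t [S sys]]] := osc_system_exists ab pY.
have [p' [t' [S' [sys' ->]]]] : exists p' (t' : nat -> R) (S' : nat -> R -> 'M[R]_(n + n)),
    osc_system a b Y p' t' S' /\ osc a b Y = osc_sum Y p' t' S'.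
  apply: (@xgetPex _ 0 [set N | exists p (t : nat -> R) S,
    osc_system a b Y p t S /\ N = osc_sum Y p t S]).
  by exists (osc_sum Y p t S), p, t, S.
have [G [pG GE]] := osc_system_primitive (oner_neq0 R) pY sys'.
exists G; split=> //; rewrite GE; apply: eq_bigr => k _.
by rewrite !muE.
Qed.

(** The differences in the dual sum are taken the other way round, hence the minus sign. *)
Lemma osc_dual_primitive a b Y : a < b -> path_on a b Y ->
  exists G, primitive (-1) a b Y G /\ osc_dual a b Y = - (G b - G a).
Proof.
move=> ab pY; have [p [t [S sys]]] := osc_system_exists ab pY.
have [p' [t' [S' [sys' ->]]]] : exists p' (t' : nat -> R) (S' : nat -> R -> 'M[R]_(n + n)),
    osc_system a b Y p' t' S' /\ osc_dual a b Y = osc_sum_dual Y p' t' S'.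
  apply: (@xgetPex _ 0 [set N | exists p (t : nat -> R) S,
    osc_system a b Y p t S /\ N = osc_sum_dual Y p t S]).
  by exists (osc_sum_dual Y p t S), p, t, S.
have m1 : -1 != 0 :> R by rewrite oppr_eq0 oner_neq0.
have [G [pG GE]] := osc_system_primitive m1 pY sys'.
exists G; split=> //; rewrite GE -sumrN; apply: eq_bigr => k _.
by rewrite !mu_dualE opprB.
Qed.

(** The factor [K] covers both choices of [Z]: the inverse square root of the Gram matrix of [Yh]
    for [Zmx], and the identity when [Z *m E = Yh]. *)
Lemma osc_compare a b Y Yh (Z : R -> 'M[R]_(n + n)) (K : R -> 'M[R]_n) :
  a < b -> path_on a b Y -> path_on a b Yh ->
  (forall t, a <= t <= b -> symplectic (Z t) /\ mxcvg (nbhs_itv a b t) Z (Z t)) ->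
  (forall t, a <= t <= b -> K t \in unitmx /\ Z t *m E = Yh t *m K t) ->
  osc a b Y - osc a b Yh =
    (mu (Y b) (Yh b))%:Z - (mu (Y a) (Yh a))%:Z
    + osc a b (fun t => invmx (Z t) *m Y t) /\
  osc_dual a b Y - osc_dual a b Yh =
    (mu_dual (Y a) (Yh a))%:Z - (mu_dual (Y b) (Yh b))%:Z
    + osc_dual a b (fun t => invmx (Z t) *m Y t).
Proof.
move=> ab pY pYh pZ ZE.
have pP : path_on a b (fun t => invmx (Z t) *m Y t).
  apply: path_on_symplectic => // t tab; have [sZ cZ] := pZ t tab.
  by split; [exact: symplectic_inv|apply: mxcvg_inv => //; exact: symplectic_unit].
split.
  have [G1 [p1 ->]] := osc_primitive ab pY; have [G2 [p2 ->]] := osc_primitive ab pYh.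
  have [G3 [p3 ->]] := osc_primitive ab pP; rewrite !muE.
  exact: primitive_compare (oner_neq0 R) (ltW ab) pY pYh pZ ZE p1 p2 p3.
have [G1 [p1 ->]] := osc_dual_primitive ab pY; have [G2 [p2 ->]] := osc_dual_primitive ab pYh.
have [G3 [p3 ->]] := osc_dual_primitive ab pP; rewrite !mu_dualE.
have m1 : -1 != 0 :> R by rewrite oppr_eq0 oner_neq0.
have := primitive_compare m1 (ltW ab) pY pYh pZ ZE p1 p2 p3.
by move: (mu_signed _ _ _) (mu_signed _ _ _) => m m'; lia.
Qed.

End Comparison.

(** * Inverse square roots *)

Section InverseSquareRoot.
Variable R : realType.

(** [- K] is negative on the whole space, so its index is [n] and the subspace of [ind_neg] is
    everything. *)
Lemma posdef_lower_bound n (K : 'M[R]_n) : posdef K ->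
  exists2 k, 0 < k & forall v : 'rV_n, k * (v *m v^T) 0 0 <= (v *m K *m v^T) 0 0.
Proof.
move=> [Ks Kpos]; have NKs : (- K)^T = - K by rewrite linearN /= Ks.
have [U [k [k0 rU Uk]]] := ind_neg NKs.
have Ufull : row_full U.
  rewrite /row_full eqn_leq rank_leq_col rU -[X in (X <= _)%N](@mxrank1 R).
  apply: ind_max => // v _ v0; rewrite mulmxN mulNmx mxE oppr_lt0; exact: Kpos.
exists k => // v; have := Uk v (submx_full _ Ufull).
by rewrite mulmxN mulNmx mxE lerN2.
Qed.

Lemma posdef_inv_sqrt n (A : 'M[R]_n) : posdef A ->
  exists K : 'M[R]_n, posdef K /\ K *m K = invmx A.
Proof.
move=> [As Apos]; have [Q [d [QQ AE]]] := symmetric_spectral As.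
have QQ' := mulmx1C QQ.
have Qu : Q \in unitmx by have [] := mulmx1_unit QQ.
have d0 i : 0 < d 0 i.
  have e0 : delta_mx 0 i *m Q != 0 :> 'rV[R]_n.
    rewrite -[X in _ != X](mul0mx _ Q); apply/negP => /eqP /(can_inj (mulmxK Qu)).
    by move=> /rowP/(_ i); rewrite !mxE !eqxx => /eqP; rewrite oner_eq0.
  have := Apos _ e0; rewrite AE quad_spectral // (bigD1 i) //= big1 ?addr0.
    by rewrite !mxE !eqxx expr1n mulr1.
  by move=> j ji; rewrite !mxE (negPf ji) andbF expr0n mulr0.
pose r : 'rV[R]_n := \row_i (Num.sqrt (d 0 i))^-1.
pose K := Q^T *m diag_mx r *m Q.
have Ks : K^T = K by rewrite !trmx_mul trmxK tr_diag_mx mulmxA.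
have KK : K *m K *m A = 1%:M.
  have rrd : diag_mx r *m diag_mx r *m diag_mx d = 1%:M.
    rewrite !mulmx_diag -diag_const_mx; congr diag_mx; apply/rowP => i.
    by rewrite !mxE -invfM -expr2 sqr_sqrtr ?ltW // mulVf // gt_eqF.
  rewrite AE /K !mulmxA -!(mulmxA _ Q Q^T) QQ !mulmx1.
  by rewrite -(mulmxA Q^T) -(mulmxA Q^T) rrd mulmx1.
exists K; split.
  split=> // v v0; pose u := v *m Q^T.
  have vE : v = u *m Q by rewrite /u -mulmxA QQ' mulmx1.
  rewrite vE quad_spectral // lt_def.
  have terms i : 0 <= r 0 i * u 0 i ^+ 2.
    by rewrite mulr_ge0 ?sqr_ge0 // mxE invr_ge0 sqrtr_ge0.
  rewrite sumr_ge0 // andbT psumr_eq0 //; apply: contra v0 => /allP u0.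
  rewrite vE (_ : u = 0) ?mul0mx //; apply/rowP => i.
  have := u0 i (mem_index_enum _); rewrite /= mulf_eq0 expf_eq0 /= !mxE.
  by rewrite invr_eq0 sqrtr_eq0 leNgt d0 /= => /eqP.
have [Au _] : A \in unitmx /\ K *m K \in unitmx.
  by have [] := mulmx1_unit KK.
by rewrite -[LHS](mulmxK Au) KK mul1mx.
Qed.

Lemma inv_sqrtmxP n (A : 'M[R]_n) : posdef A ->
  posdef (inv_sqrtmx A) /\ inv_sqrtmx A *m inv_sqrtmx A = invmx A.
Proof. by move=> /posdef_inv_sqrt; exact: xgetPex. Qed.

Lemma posdef_unit n (A : 'M[R]_n) : posdef A -> A \in unitmx.
Proof.
move=> [_ Apos]; rewrite -row_free_unit -kermx_eq0; apply/rowV0P => v /sub_kermxP vA.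
by apply/eqP; apply: contraT => /Apos; rewrite vA mul0mx mxE ltxx.
Qed.

(* The square root is Lipschitz near a positive definite matrix: if [D = K - K0]
   then [K^2 - K0^2 = K D + D K0], and pairing with [D] bounds [k |D|^2]. *)
Lemma posdef_sqrt_dist n (K K0 : 'M[R]_n) (k : R) :
  posdef K -> posdef K0 -> 0 < k ->
  (forall v : 'rV_n, k * (v *m v^T) 0 0 <= (v *m K0 *m v^T) 0 0) ->
  forall i j, ((K - K0) i j) ^+ 2 <=
    (\sum_l \sum_m ((K *m K - K0 *m K0) l m) ^+ 2) / k ^+ 2.
Proof.
move=> [Ks Kpos] [K0s _] k0 K0k i j.
pose D := K - K0; pose C := K *m K - K0 *m K0.
have Ds : D^T = D by rewrite linearB /= Ks K0s.
have Dlm l m : D m l = D l m.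
  by have /matrixP/(_ l m) := Ds; rewrite [_^T _ _]mxE.
have CE : C = K *m D + D *m K0 by rewrite mulmxBr mulmxBl addrA subrK.
have quad (B : 'M[R]_n) : \tr (D *m B *m D) = \sum_l (row l D *m B *m (row l D)^T) 0 0.
  rewrite /mxtrace; apply: eq_bigr => l _.
  rewrite tr_row Ds -row_mul [LHS]mxE [RHS]mxE; apply: eq_bigr => m _.
  by rewrite [row _ _ _ _]mxE [col _ _ _ _]mxE.
have normD : \tr (D *m D) = \sum_l \sum_m (D l m) ^+ 2.
  rewrite /mxtrace; apply: eq_bigr => l _; rewrite mxE; apply: eq_bigr => m _.
  by rewrite Dlm expr2.
have Kge0 : 0 <= \tr (D *m K *m D).
  rewrite quad sumr_ge0 // => l _; case: (eqVneq (row l D) 0) => [->|/Kpos/ltW //].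
  by rewrite !mul0mx mxE.
have K0ge : k * \tr (D *m D) <= \tr (D *m K0 *m D).
  have := quad 1%:M; rewrite mulmx1 => ->; rewrite quad mulr_sumr.
  by apply: ler_sum => l _; rewrite mulmx1; exact: K0k.
have trC : \tr (D *m C) = \tr (D *m K *m D) + \tr (D *m K0 *m D).
  by rewrite CE mulmxDr mxtraceD mulmxA [X in _ + X]mxtrace_mulC.
have le1 : k * \tr (D *m D) <= \tr (D *m C) by rewrite trC; lra.
(* Young's inequality with weights adapted to [k]: half of the [k |D|^2] in [le1] is absorbed,
   leaving [|C|^2 / (2 k)]. *)
have le2 : \tr (D *m C) <= \sum_l \sum_m (k / 2 * (D l m) ^+ 2 + (2 * k)^-1 * (C l m) ^+ 2).
  rewrite mxtrace_mulC; apply: ler_sum => l _; rewrite mxE; apply: ler_sum => m _.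
  rewrite (Dlm l m).
  rewrite -subr_ge0 (_ : _ - _ = (2 * k)^-1 * (k * D l m - C l m) ^+ 2).
    by rewrite mulr_ge0 ?sqr_ge0 // invr_ge0 mulr_ge0 // ltW.
  by field; rewrite gt_eqF.
have Dij : (D i j) ^+ 2 <= \tr (D *m D).
  rewrite normD (bigD1 i) //= (bigD1 j) //= -addrA lerDl addr_ge0 ?sumr_ge0 // => l _.
    exact: sqr_ge0.
  by rewrite sumr_ge0 // => m _; exact: sqr_ge0.
rewrite -/D -/C; apply: le_trans Dij _.
move: le2; under eq_bigr do rewrite big_split -!mulr_sumr /=.
rewrite big_split -!mulr_sumr -normD /= => le2.
set c := \sum_l _ in le2 *; set N := \tr (D *m D) in le1 le2 *.
have k2 : 0 < k ^+ 2 by rewrite exprn_gt0.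
rewrite ler_pdivlMr //.
have : k * N <= k / 2 * N + (2 * k)^-1 * c by apply: le_trans le2.
rewrite -(ler_pM2l k0) => h.
have -> : c = k * ((2 * k)^-1 * c) * 2 by field; rewrite gt_eqF.
by rewrite mulrDr in h; lra.
Qed.

(** The squares of the roots are the inverses, which converge, and [posdef_sqrt_dist] bounds the
    distance of the roots by that of their squares. *)
Lemma mxcvg_inv_sqrt (T : Type) (F : set_system T) {FF : Filter F} n
    (A : T -> 'M[R]_n) (A0 : 'M[R]_n) :
  (\forall t \near F, posdef (A t)) -> posdef A0 -> mxcvg F A A0 ->
  mxcvg F (fun t => inv_sqrtmx (A t)) (inv_sqrtmx A0).
Proof.
move=> Apos A0pos AA i j.
have [K0pos K0E] := inv_sqrtmxP A0pos; set K0 := inv_sqrtmx A0 in K0pos K0E *.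
have [k k0 K0k] := posdef_lower_bound K0pos.
pose f t := \sum_l \sum_m ((invmx (A t) - invmx A0) l m) ^+ 2.
have f0 : f t @[t --> F] --> (0 : R).
  have -> : (0 : R) = \sum_(l < n) \sum_(m < n) (invmx A0 l m - invmx A0 l m) ^+ 2.
    by rewrite big1 // => l _; rewrite big1 // => m _; rewrite subrr expr0n.
  apply: cvg_big_sum => l _; apply: cvg_big_sum => m _.
  under eq_fun do rewrite !mxE expr2; rewrite expr2.
  have cB : invmx (A t) l m - invmx A0 l m @[t --> F] --> invmx A0 l m - invmx A0 l m.
    by apply: cvgB; [exact: (mxcvg_inv AA (posdef_unit A0pos))|exact: cvg_cst].
  exact: cvgM.
apply/cvgrPdist_lt => e e0.
have ke : 0 < e ^+ 2 * k ^+ 2 by rewrite mulr_gt0 ?exprn_gt0.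
have /cvgrPdist_lt/(_ _ ke) fsmall := f0.
near=> t.
have Atpos : posdef (A t) by near: t; exact: Apos.
have [Kpos KE] := inv_sqrtmxP Atpos.
have ft : f t < e ^+ 2 * k ^+ 2.
  suff : `|0 - f t| < e ^+ 2 * k ^+ 2.
    by rewrite sub0r normrN ltr_norml => /andP[].
  by near: t; exact: fsmall.
have := posdef_sqrt_dist Kpos K0pos k0 K0k i j; rewrite KE K0E -/(f t) => le.
rewrite distrC -(ltr_pXn2r (n := 2)) ?nnegrE // ?ltW //.
rewrite real_normK ?num_real // (le_lt_trans _ (_ : f t / k ^+ 2 < _)) //.
  by move: le; rewrite !mxE.
by rewrite ltr_pdivrMr // exprn_gt0.
Unshelve. all: by end_near.
Qed.

End InverseSquareRoot.

(** * The symplectic orthogonal matrix of a Lagrangian plane *)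

Section OrthogonalSymplectic.
Variables (R : realType) (n : nat).
Implicit Types Y : 'M[R]_(n + n, n).

Lemma gram_posdef Y : \rank Y = n -> posdef (Y^T *m Y).
Proof.
move=> rY; split; first by rewrite trmx_mul trmxK.
move=> v v0; have -> : v *m (Y^T *m Y) *m v^T = (v *m Y^T) *m (v *m Y^T)^T.
  by rewrite trmx_mul trmxK !mulmxA.
apply: dotmx_gt0; apply: contra v0 => /eqP vY.
have Yf : row_free Y^T by rewrite /row_free mxrank_tr rY.
by apply/eqP/(row_free_inj Yf); rewrite vY mul0mx.
Qed.

Lemma Zmx_E Y : Zmx Y *m Emx n = Y *m inv_sqrtmx (Y^T *m Y).
Proof. by rewrite /Zmx mul_row_col mulmx0 add0r mulmx1. Qed.

(** The frame [N = Y *m K] has orthonormal columns and is isotropic, so the blocks of [Z^T J Z]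
    reduce to [N^T J N = 0] and [N^T N = 1] up to sign. *)
Lemma Zmx_symplectic Y : lagrangian_plane Y -> symplectic (Zmx Y).
Proof.
move=> [Y0 rY]; have Ypos := gram_posdef rY.
have [[Ks _] KK] := inv_sqrtmxP Ypos; have Yu := posdef_unit Ypos.
rewrite /symplectic /Zmx; set K := inv_sqrtmx _ in Ks KK *.
have KAK : K^T *m Y^T *m Y *m K = 1%:M.
  by rewrite Ks -(mulmxA K); apply: mulmx1C; rewrite (mulmxA K K) KK mulVmx.
have NJN : (Y *m K)^T *m Jmx R n *m (Y *m K) = 0.
  by rewrite trmx_mul -!mulmxA (mulmxA _ Y K) (mulmxA Y^T) (mulmxA Y^T) Y0 mul0mx mulmx0.
have NN : (Y *m K)^T *m (Y *m K) = 1%:M by rewrite trmx_mul !mulmxA.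
rewrite -(mulmxA (Jmx R n)); move: (Y *m K) NJN NN => N NJN NN.
have JN : (Jmx R n *m N)^T *m Jmx R n = N^T.
  by rewrite trmx_mul trmx_J mulmxN mulNmx -mulmxA mulJJ mulmxN mulmx1 opprK.
rewrite tr_row_mx mul_col_mx mul_col_row JN NN NJN !mulmxA NJN.
by rewrite -(mulmxA N^T) mulJJ mulmxN mulmx1 mulNmx NN.
Qed.

End OrthogonalSymplectic.

Theorem theorem5p1 (R : realType) (n : nat) (a b : R) (hab : a < b)
    (Y Yh : R -> 'M[R]_(n + n, n))
    (hY : lagrangian_path a b Y) (hYh : lagrangian_path a b Yh) :
  [/\ osc a b Y - osc a b Yh =
        (mu (Y b) (Yh b))%:Z - (mu (Y a) (Yh a))%:Z
        + osc a b (fun t => invmx (Zmx (Yh t)) *m Y t),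
      osc_dual a b Y - osc_dual a b Yh =
        (mu_dual (Y a) (Yh a))%:Z - (mu_dual (Y b) (Yh b))%:Z
        + osc_dual a b (fun t => invmx (Zmx (Yh t)) *m Y t) &
      forall Zh : R -> 'M[R]_(n + n),
        {within `[a, b], continuous Zh} ->
        (forall t, a <= t <= b -> symplectic (Zh t)) ->
        (forall t, a <= t <= b -> Zh t *m Emx n = Yh t) ->
        osc a b Y - osc a b Yh =
          (mu (Y b) (Yh b))%:Z - (mu (Y a) (Yh a))%:Z
          + osc a b (fun t => invmx (Zh t) *m Y t) /\
        osc_dual a b Y - osc_dual a b Yh =
          (mu_dual (Y a) (Yh a))%:Z - (mu_dual (Y b) (Yh b))%:Z
          + osc_dual a b (fun t => invmx (Zh t) *m Y t)].
Proof.
have pY : path_on a b Y by apply/lagrangian_pathP.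
have pYh : path_on a b Yh by apply/lagrangian_pathP.
pose K t := inv_sqrtmx ((Yh t)^T *m Yh t).
have gpos t : a <= t <= b -> posdef ((Yh t)^T *m Yh t).
  by move=> tab; have [[_ rY] _] := pYh t tab; exact: gram_posdef.
have [] : osc a b Y - osc a b Yh =
    (mu (Y b) (Yh b))%:Z - (mu (Y a) (Yh a))%:Z
    + osc a b (fun t => invmx (Zmx (Yh t)) *m Y t) /\
  osc_dual a b Y - osc_dual a b Yh =
    (mu_dual (Y a) (Yh a))%:Z - (mu_dual (Y b) (Yh b))%:Z
    + osc_dual a b (fun t => invmx (Zmx (Yh t)) *m Y t).
  (* [Zmx (Yh t) *m E] equals [Yh t *m K t], and [Zmx (Yh t)] is continuous because the inverse
     square root of the Gram matrix is. *)
  apply: (osc_compare (K := K)) => // t tab; have [lYh cYh] := pYh t tab.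
    split; first exact: Zmx_symplectic.
    have cK : mxcvg (nbhs_itv a b t) K (K t).
      apply: mxcvg_inv_sqrt; [ |exact: gpos| ].
        by apply/near_itvP; exists 1 => // u uab _; exact: gpos.
      by apply: mxcvg_mul => //; exact: mxcvg_tr.
    apply: mxcvg_row; apply: mxcvg_mul => //.
    by apply: mxcvg_mul => //; exact: mxcvg_cst.
  split; last exact: Zmx_E.
  have [_ KK] := inv_sqrtmxP (gpos t tab).
  have : K t *m K t \in unitmx by rewrite KK unitmx_inv; exact/posdef_unit/gpos.
  by rewrite unitmx_mul => /andP[].
move=> E1 E2; split; [exact: E1|exact: E2|move=> Zh cZ sZ ZE].
apply: (osc_compare (K := fun=> 1%:M)) => // t tab.
  split; first exact: sZ.
  by apply/mxcvgP; move/subspace_continuousP : cZ; apply; rewrite /= in_itv.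
by rewrite unitmx1 mulmx1; split=> //; exact: ZE.
Qed.
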